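(* Let $\Lambda=\Lambda(\mathcal{W},\mathcal{L})\subset\mathbb{R}^2$ be a Hammarhjelm example and let $D\subset\mathbb{R}^2$ be a convex averaging set. Then for any $\varepsilon>0$, as $T\to\infty$, $$\left|\frac{\#(\Lambda_{\mathrm{vis}}\cap TD)}{\mathrm{vol}(TD)}-\theta(\Lambda_{\mathrm{vis}})\right|=O\left(\mathrm{vol}(TD)^{-\frac14+\varepsilon}\right).$$
   Context: Let $K$ be a real quadratic number field whose ring of integers $\mathcal{O}_K$ is a principal ideal domain, $\sigma$ the non-trivial Galois automorphism of $K$, and $\lambda>1$ the fundamental unit, so $\mathcal{O}_K^\times=\{\pm\lambda^i: i\in\mathbb{Z}\}$ (with $K\subset\mathbb{R}$). $K$ satisfies the Hammarhjelm condition if $|\sigma(\pi)|>1$ for every prime element $\pi\in\mathcal{O}_K$ with $1<\pi<\lambda$. A Hammarhjelm example is a cut-and-project set $\Lambda(\mathcal{W},\mathcal{L})=\{\pi_{\mathrm{phys}}(y): y\in\mathcal{L},\ \pi_{\mathrm{int}}(y)\in\mathcal{W}\}\subset\mathbb{R}^2$, where $\pi_{\mathrm{phys}},\pi_{\mathrm{int}}:\mathbb{R}^4=\mathbb{R}^2\oplus\mathbb{R}^2\to\mathbb{R}^2$ are the projections to the first and second summand, $\mathcal{L}=\{(x_1,x_2,\sigma(x_1),\sigma(x_2)): x_1,x_2\in\mathcal{O}_K\}$ for a real quadratic field $K$ satisfying the Hammarhjelm condition, and the window $\mathcal{W}\subset\mathbb{R}^2$ is bounded with non-empty interior (and Jordan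 measurable), convex and centrally symmetric ($\mathcal{W}=-\mathcal{W}$). For a locally finite set $\mathcal{P}\subset\mathbb{R}^2$, $\mathcal{P}_{\mathrm{vis}}=\{y\in\mathcal{P}\smallsetminus\{0\}: ty\notin\mathcal{P}\ \text{for all } t\in(0,1)\}$. An averaging set is a bounded, Jordan measurable $D\subset\mathbb{R}^2$ with $\mathrm{vol}(D)>0$; for $T>0$, $TD=\{tx:x\in D,\ t\in[0,T]\}$, and $\theta(\mathcal{P})=\lim_{T\to\infty}\frac{\#(\mathcal{P}\cap TD)}{\mathrm{vol}(TD)}$ is the asymptotic density. The implicit constant may depend on $K,\mathcal{W},D,\varepsilon$ but not on $T$. *)

(* Defs.v *)
From HB Require Import structures.
From mathcomp Require Import all_boot all_order all_algebra all_field finmap.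
From mathcomp Require Import all_classical all_reals all_analysis.

Set Implicit Arguments.
Unset Strict Implicit.
Unset Printing Implicit Defensive.

Import Order.TTheory GRing.Theory Num.Theory.
Import numFieldNormedType.Exports.

Local Open Scope classical_set_scope.
Local Open Scope ring_scope.

Section RingOfIntegers.
Variable K : fieldExtType rat.

Definition ringOfIntegers : set K :=
  [set x | integralOver (intr : int -> K) x].

Local Notation OK := ringOfIntegers.

(* The conjunct [x != 0] is needed since [0^-1 = 0] in MathComp. *)
Definition OK_unit (x : K) : Prop := [/\ x != 0, OK x & OK x^-1].

Definition OK_dvd (x y : K) : Prop := exists2 c, OK c & y = c * x.

Definition OK_prime (p : K) : Prop :=
  [/\ OK p, p != 0, ~ OK_unit p &
      forall a b, OK a -> OK b -> OK_dvd p (a * b) -> OK_dvd p a \/ OK_dvd p b].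

Definition OK_ideal (I : set K) : Prop :=
  [/\ I `<=` OK, I 0,
      forall x y, I x -> I y -> I (x + y) &
      forall a x, OK a -> I x -> I (a * x)].

Definition OK_pid : Prop :=
  forall I, OK_ideal I ->
    exists2 g, OK g & I = [set a * g | a in OK].

Variables (R : realType) (iota : {rmorphism K -> R}) (sigma : {rmorphism K -> K}).

(* An identification of [K] with a subfield of [R] is part of the data: [iota]. *)
Definition fundamental_unit (lambda : K) : Prop :=
  1 < iota lambda /\
  forall u, OK_unit u <-> exists i : int, u = lambda ^ i \/ u = - lambda ^ i.

Definition nontrivial_automorphism : Prop :=
  bijective sigma /\ exists x, sigma x != x.

Definition hammarhjelm_condition (lambda : K) : Prop :=
  forall p, OK_prime p -> 1 < iota p -> iota p < iota lambda ->
    1 < `|iota (sigma p)|.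

(* [(R * R) * (R * R)] plays the role of R^2 (+) R^2 = R^4. *)
Definition minkowski_lattice : set ((R * R) * (R * R)) :=
  [set ((iota x.1, iota x.2), (iota (sigma x.1), iota (sigma x.2)))
  | x in [set x : K * K | OK x.1 /\ OK x.2]].

End RingOfIntegers.

Section Plane.
Variable R : realType.

Definition cut_and_project (W : set (R * R)) (L : set ((R * R) * (R * R))) :
    set (R * R) :=
  [set y.1 | y in [set y | L y /\ W y.2]].

Definition visible (P : set (R * R)) : set (R * R) :=
  [set y | [/\ P y, y != 0 &
    forall t : R, 0 < t -> t < 1 -> ~ P (t *: (y : R^o * R^o))]].

Definition lebesgue2 : set (measurableTypeR R * measurableTypeR R) -> \bar R :=
  (@lebesgue_measure R \x @lebesgue_measure R)%E.

(* The product measure is meaningful on Borel sets only, and a Jordan measurable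
   (even a convex) set need not be Borel.  The outer measure agrees with the
   Jordan content on every Jordan measurable set. *)
Definition vol (A : set (R * R)) : R := fine (mu_ext lebesgue2 A).

(* The Lebesgue criterion, for bounded sets. *)
Definition jordan_measurable (A : set (R * R)) : Prop :=
  bounded_set (A : set (R^o * R^o)) /\ lebesgue2 (closure A `\` interior A) = 0%E.

Definition convex2 (A : set (R * R)) : Prop :=
  convex_set (A : set (convex_lmodType (R^o * R^o)%type)).

Definition centrally_symmetric (A : set (R * R)) : Prop :=
  A = [set - x | x in A].

Definition hammarhjelm_window (W : set (R * R)) : Prop :=
  [/\ jordan_measurable W, interior W !=set0, convex2 W & centrally_symmetric W].

Definition averaging_set (D : set (R * R)) : Prop :=
  jordan_measurable D /\ 0 < vol D.

(* The set [TD] consists of all [t x] with [0 <= t <= T], not only [t = T]. *)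
Definition dilate (T : R) (D : set (R * R)) : set (R * R) :=
  [set y | exists t x, [/\ 0 <= t, t <= T, D x & y = t *: (x : R^o * R^o)]].

(* [fset_set] is empty on infinite sets; it is only meant to be used here for
   locally finite [P] and bounded [D]. *)
Definition frequency (P D : set (R * R)) (T : R) : R :=
  #|` fset_set (P `&` dilate T D)|%:R / vol (dilate T D).

Definition asymptotic_density (P D : set (R * R)) (theta : R) : Prop :=
  frequency P D T @[T --> +oo] --> theta.

End Plane.

(* Main.v *)
Require Import Defs.
From HB Require Import structures.
From mathcomp Require Import all_boot all_order all_algebra all_field finmap.
From mathcomp Require Import all_classical all_reals all_analysis.
From mathcomp Require Import measurable_realfun ring lra.

Import Order.TTheory GRing.Theory Num.Theory.
Import numFieldNormedType.Exports.

Local Open Scope classical_set_scope.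
Local Open Scope ring_scope.

Set Implicit Arguments.
Unset Strict Implicit.
Unset Printing Implicit Defensive.

(** Write [x] for a vector of two integers of [K], [iota x] for its physical and
[sigma x] for its internal part, and [lambda] for the fundamental unit.

The visible points are arithmetic.  A competitor of a primitive vector [x] on the
segment from the origin is [b x] with [b] an integer and [0 < iota b < 1].  If
[lambda * sigma x] is outside the window, such a [b] satisfies
[|sigma b| < lambda], and then [c = lambda b] satisfies [1 < iota c < lambda] and
[|sigma c| < 1].  The Hammarhjelm condition excludes this for primes, hence, by
unique factorization, for all integers ([hammarhjelm_integer]).  So the visible
points are the primitive vectors with [sigma x] in [W] and [lambda * sigma x] not
in [W] ([visible_primitive]), and their number is the difference of two counts of
primitive vectors with [iota x] in a dilate of a convex body [A] and [sigma x] in a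
dilate of [W].

The vectors with [iota x] in [a A] and [sigma x] in [b W] are counted first without
the primitivity.  Multiplication by units trades [a] for [b], so both may be assumed
to be of the order of [r = sqrt (a b)].  The cells of the lattice points then lie in
a dilate of [A * W] larger by a bounded amount, and cover a dilate smaller by a
bounded amount ([lattice_count]); this gives a constant times [r ^ 4] up to
[O(r ^ 3)].  The same estimate holds for small [r], because a non-zero integer has
norm at least [1] and therefore no non-zero vector is left ([lattice_asymptotics]).

Primitivity is imposed one prime at a time.  The vectors divisible by a prime [p]
correspond to a window pair in which [r] is replaced by [r / sqrt (N p)].  Hence
sieving by a finite set of primes multiplies the main term by the product of
[1 - N p ^ (- 2)] and the error term by the product of [1 + N p ^ (- 3 / 2)]
([sieve]).  At most two classes of primes have a given norm, so the second product
is bounded uniformly in the set of primes ([prime_sequence]).  For fixed dilation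
parameter [T] all sufficiently long lists of primes give the same count, so the list
may grow with [T] fixed, which replaces the finite Euler product by its limit
without changing the error term.  The result is an error [O(T ^ (3 / 2))] for a count of order [T ^ 2],
that is [O(vol (T D) ^ (- 1 / 4))] for the frequency ([visible_count_bound]). *)

(** * Integers of a real quadratic field *)

Section Quadratic.
Variables (K : fieldExtType rat) (sigma : {rmorphism K -> K}).
Hypothesis hK : \dim {: K} = 2%N.
Hypothesis hsigma : nontrivial_automorphism sigma.
Local Notation OK := (@ringOfIntegers K).

Lemma OK_int (n : int) : OK n%:~R.
Proof. exact: integral_id. Qed.

Lemma OK0 : OK 0. Proof. exact: (OK_int 0). Qed.
Lemma OK1 : OK 1. Proof. exact: (OK_int 1). Qed.

Lemma OKD x y : OK x -> OK y -> OK (x + y).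
Proof. exact: integral_add. Qed.

Lemma OKB x y : OK x -> OK y -> OK (x - y).
Proof. exact: integral_sub. Qed.

Lemma OKN x : OK x -> OK (- x).
Proof. exact: integral_opp. Qed.

Lemma OKM x y : OK x -> OK y -> OK (x * y).
Proof. exact: integral_mul. Qed.

Lemma OK_sigma x : OK x -> OK (sigma x).
Proof.
case=> p mp rp; exists p => //.
have -> : map_poly intr p = map_poly sigma (map_poly intr p) :> {poly K}.
  by rewrite -map_poly_comp; apply: eq_map_poly => z /=; rewrite rmorph_int.
exact: rmorph_root.
Qed.

Lemma sigma_alg (q : rat) : sigma q%:A = q%:A.
Proof.
have e : q%:A = ratr q :> K by exact: (fmorph_eq_rat (in_alg K)).
by rewrite e fmorph_rat.
Qed.

Lemma alg_intr (n : int) : n%:~R%:A = n%:~R :> K.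
Proof. exact: (rmorph_int (in_alg K)). Qed.

(** The detour through the algebraic numbers supplies the integral closedness of
[Z]. *)
Lemma OK_rat_int (q : rat) : OK q%:A -> exists n : int, q%:A = n%:~R :> K.
Proof.
case=> p mp rp.
have rq : root (map_poly (intr : int -> rat) p) q.
  rewrite -(fmorph_root (in_alg K)) -map_poly_comp.
  by rewrite (eq_map_poly (g := intr)) // => z /=; rewrite alg_intr.
have rC : root (map_poly (intr : int -> algC) p) (ratr q).
  rewrite (eq_map_poly (g := ratr \o (intr : int -> rat))); last first.
    by move=> z /=; rewrite ratr_int.
  by rewrite map_poly_comp; apply: rmorph_root.
have qA : (ratr q : algC) \in Aint.
  apply: (root_monic_Aint rC); first exact: monic_map.
  by apply/polyOverP => i; rewrite coef_map /= intr_int.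
have /intrP[n] := Cint_rat_Aint (Crat_rat q) qA.
rewrite -ratr_int => /(fmorph_inj (ratr : {rmorphism rat -> algC})) ->.
by exists n; rewrite alg_intr.
Qed.

Lemma rat_basis (x : K) : (forall q : rat, x <> q%:A) ->
  forall z, exists a b : rat, z = a%:A + b%:A * x.
Proof.
move=> xQ z.
have fx : free [:: x; 1].
  rewrite free_cons span_seq1 seq1_free oner_neq0 andbT.
  by apply/negP => /vlineP[q] /xQ.
have bx : basis_of fullv [:: x; 1] by rewrite basisEfree fx subvf hK.
have : z \in fullv by rewrite memvf.
rewrite -(span_basis bx) span_cons span_seq1 => /memv_addP[u /vlineP[b ->]].
case=> v /vlineP[a ->] ->; exists a, b.
by rewrite -[b *: x]mulr_algl addrC.
Qed.

(** Otherwise [1] and [x] would span [K], and [sigma] would be the identity. *)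
Lemma sigma_fixed x : sigma x = x -> exists q : rat, x = q%:A.
Proof.
move=> sx; apply: contrapT => nx.
have [_ [z]] := hsigma.
have [a [b ->]] := rat_basis (x := x) (fun q xq => nx (ex_intro _ q xq)) z.
by rewrite rmorphD rmorphM !sigma_alg sx eqxx.
Qed.

(** An irrational [x] is a root of a quadratic polynomial over the rationals, and
[sigma x], being a different root, is the other one. *)
Lemma trace_norm_rat x :
  exists t n : rat, x + sigma x = t%:A /\ x * sigma x = n%:A.
Proof.
have [[q ->]|nx] := pselect (exists q : rat, x = q%:A).
  by exists (q + q), (q * q); rewrite sigma_alg scalerDl mulr_algl scalerA.
have xQ q : x <> q%:A by move=> xq; apply: nx; exists q.
have [a [b x2]] := rat_basis xQ (x ^+ 2).
have y2 : sigma x ^+ 2 = a%:A + b%:A * sigma x.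
  by rewrite -rmorphXn x2 rmorphD rmorphM !sigma_alg.
have xy : x - sigma x != 0.
  by rewrite subr_eq0; apply/eqP => /esym /sigma_fixed.
have sE : x + sigma x = b%:A.
  apply: (mulfI xy); rewrite -subr_sqr x2 y2; ring.
exists b, (- a); split => //.
rewrite scaleNr -[LHS]opprK; congr (- _).
have -> : sigma x = b%:A - x by rewrite -sE addrC addKr.
by rewrite mulrBr -expr2 x2; ring.
Qed.

Lemma trace_int x : OK x -> exists n : int, x + sigma x = n%:~R.
Proof.
move=> Ox; have [t [_ [tE _]]] := trace_norm_rat x.
have : OK (x + sigma x) by apply: OKD => //; apply: OK_sigma.
by rewrite tE; apply: OK_rat_int.
Qed.

Lemma norm_int x : OK x -> exists n : int, x * sigma x = n%:~R.
Proof.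
move=> Ox; have [_ [n [_ nE]]] := trace_norm_rat x.
have : OK (x * sigma x) by apply: OKM => //; apply: OK_sigma.
by rewrite nE; apply: OK_rat_int.
Qed.

Lemma sigmaK : involutive sigma.
Proof.
move=> x; have [t [_ [tE _]]] := trace_norm_rat x.
have : sigma (x + sigma x) = x + sigma x by rewrite tE sigma_alg.
by rewrite rmorphD addrC => /addIr.
Qed.

Section Norm.
Variables (R : realType) (iota : {rmorphism K -> R}).

Definition absnorm (x : K) : R := `|iota x * iota (sigma x)|.

Lemma absnormM x y : absnorm (x * y) = absnorm x * absnorm y.
Proof. by rewrite /absnorm !rmorphM -normrM; congr `|_|; ring. Qed.

Lemma absnorm_sigma x : absnorm (sigma x) = absnorm x.
Proof. by rewrite /absnorm sigmaK mulrC. Qed.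

Lemma absnorm_eq0 x : (absnorm x == 0) = (x == 0).
Proof. by rewrite /absnorm normr_eq0 mulf_eq0 !fmorph_eq0 orbb. Qed.

Lemma absnorm_nat x : OK x -> exists n : nat, absnorm x = n%:R.
Proof.
move=> /norm_int[n nE]; exists (absz n).
by rewrite /absnorm -rmorphM nE rmorph_int pmulrn abszE intr_norm.
Qed.

Lemma absnorm_ge1 x : OK x -> x != 0 -> 1 <= absnorm x.
Proof.
move=> Ox; have [n] := absnorm_nat Ox.
by rewrite -absnorm_eq0 => ->; rewrite pnatr_eq0 ler1n lt0n.
Qed.

Lemma unit_absnorm x : OK x -> OK_unit x <-> absnorm x = 1.
Proof.
move=> Ox; split.
  case=> x0 _ OV; apply/eqP; rewrite eq_le absnorm_ge1 // andbT.
  have := absnorm_ge1 OV; rewrite invr_eq0 => /(_ x0) h.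
  rewrite -[leLHS]mulr1 (le_trans (ler_wpM2l _ h)) ?normr_ge0 //.
  by rewrite -absnormM divff // /absnorm !rmorph1 mulr1 normr1.
move=> nx.
have x0 : x != 0 by rewrite -absnorm_eq0 nx oner_eq0.
have [n nE] := norm_int Ox.
have n2 : (n ^+ 2)%:~R = 1 :> K.
  apply: (fmorph_inj iota); rewrite rmorph_int rmorph1 rmorphXn /=.
  move: nx; rewrite /absnorm -rmorphM nE rmorph_int => nx.
  by rewrite -real_normK ?num_real // nx expr1n.
split => //.
have -> : x^-1 = n%:~R * sigma x.
  by apply: (mulfI x0); rewrite divff // mulrCA nE -intrM -expr2 n2.
by apply: OKM; [exact: OK_int | exact: OK_sigma].
Qed.

(** The square of [d x = iota x - iota (sigma x)] is the discriminant of the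
characteristic polynomial of [x], a natural number.  So [d] has a least positive
value on the integers, and by division with remainder an integer attaining it
generates all of them together with [1]. *)
Lemma integral_basis : exists w, [/\ OK w, iota (sigma w) < iota w &
  forall x, OK x -> exists m n : int, x = m%:~R + n%:~R * w].
Proof.
pose d x := iota x - iota (sigma x).
have d2 x : OK x -> exists k : nat, d x ^+ 2 = k%:R.
  move=> Ox; have [t tE] := trace_int Ox; have [n nE] := norm_int Ox.
  pose D : int := t ^+ 2 - 4 * n.
  have dE : d x ^+ 2 = D%:~R.
    rewrite /d /D intrB [t ^+ 2]expr2 !intrM -!(rmorph_int iota) -tE -nE.
    by rewrite rmorphD !rmorphM !rmorph_int; ring.
  exists (absz D); rewrite pmulrn abszE intr_norm -dE.
  by rewrite ger0_norm // sqr_ge0.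
pose P k := `[< exists x, [/\ OK x, 0 < d x & d x ^+ 2 = k%:R] >].
(* Multiplying an element moved by [sigma] by denominators of its trace and its norm
makes it integral. *)
have exP : exists k, P k.
  have [_ [z0 /eqP sz0]] := hsigma.
  have [z [Oz sz]] : exists z, OK z /\ sigma z <> z.
    apply: contrapT => H.
    have [t [n [tE nE]]] := trace_norm_rat z0.
    pose D : int := denq t * denq n.
    have D0 : D%:~R != 0 :> K.
      apply/eqP => /(congr1 iota); rewrite rmorph_int rmorph0 => /eqP.
      by rewrite intr_eq0 mulf_eq0 !denq_eq0.
    have rt : t%:A * (denq t)%:~R = (numq t)%:~R :> K.
      by rewrite -!alg_intr mulr_algl scalerA -numqE.
    have rn : n%:A * (denq n)%:~R = (numq n)%:~R :> K.
      by rewrite -!alg_intr mulr_algl scalerA -numqE.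
    apply: H; exists (D%:~R * z0); split; last first.
      by rewrite rmorphM rmorph_int => /(mulfI D0).
    pose T : int := numq t * denq n; pose N : int := numq n * denq t * D.
    exists ('X^2 - T%:P * 'X + N%:P).
      apply/monicP; rewrite -addrA lead_coefDl ?lead_coefXn //.
      rewrite size_polyXn ltnS (leq_trans (size_polyD _ _)) // geq_max.
      rewrite size_polyN (leq_trans (size_polyC_leq1 _)) // andbT.
      rewrite (leq_trans (size_polyMleq _ _)) // size_polyX addn2 /= ltnS.
      exact: size_polyC_leq1.
    rewrite rootE rmorphD rmorphB /= map_polyXn rmorphM /= map_polyX !map_polyC /=.
    rewrite !hornerE /= /T /N /D !rmorphM /= -rt -rn -tE -nE.
    by apply/eqP; ring.
  have dz : d z != 0.
    by rewrite subr_eq0; apply/eqP => /fmorph_inj /esym.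
  have [dp|dn] := ltP 0 (d z).
    by have [k kE] := d2 _ Oz; exists k; apply/asboolP; exists z.
  have [k kE] := d2 _ (OKN Oz); exists k; apply/asboolP; exists (- z).
  split=> //; first exact: OKN.
  have -> : d (- z) = - d z by rewrite /d !rmorphN; ring.
  by rewrite oppr_gt0 lt_neqAle dz.
case: (ex_minnP exP) => k /asboolP[w [Ow dw dwk]] kmin.
exists w; split=> //; first by rewrite -subr_gt0.
move=> x Ox; pose n := Num.floor (d x / d w).
have Oy : OK (x - n%:~R * w) by apply: OKB => //; apply: OKM => //; apply: OK_int.
have dy : d (x - n%:~R * w) = d x - n%:~R * d w.
  by rewrite /d !rmorphB !rmorphM !rmorph_int; ring.
have /andP[n1 n2] := floor_itv (d x / d w).
have dy0 : 0 <= d (x - n%:~R * w) by rewrite dy subr_ge0 -ler_pdivlMr.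
have dyw : d (x - n%:~R * w) < d w.
  by rewrite dy ltrBlDl -[X in _ + X]mul1r -mulrDl -ltr_pdivrMr //; move: n2; rewrite intrD.
have dy00 : d (x - n%:~R * w) = 0.
  apply/eqP; rewrite eq_le dy0 andbT leNgt; apply/negP => dyp.
  have [j jE] := d2 _ Oy.
  have /kmin : P j by apply/asboolP; exists (x - n%:~R * w).
  by rewrite leqNgt -(ltr_nat R) -jE -dwk ltrXn2r // ?nnegrE ?ltW // dyw.
have /sigma_fixed[q qE] : sigma (x - n%:~R * w) = x - n%:~R * w.
  by apply: (fmorph_inj iota); move/eqP: dy00; rewrite subr_eq0 => /eqP ->.
have [m mE] : exists m : int, q%:A = m%:~R :> K by apply: OK_rat_int; rewrite -qE.
by exists m, n; rewrite -mE -qE subrK.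
Qed.

End Norm.
End Quadratic.

(** * Prime factorization and visible points *)

(** For [L] the fundamental unit this normalizes elements up to units; for [L] its
square it balances the sizes of two windows. *)
Lemma expz_bracket (R : realType) (L y : R) : 1 < L -> 0 < y ->
  exists k : int, 1 <= L ^ k * y < L.
Proof.
move=> L1 y0; have L0 : 0 < L by apply: lt_trans L1.
have lL : 0 < ln L by rewrite ln_gt0.
have LX (k : int) : L ^ k = expR (k%:~R * ln L).
  by rewrite mulrC expRM lnK ?powR_intmul // ltW.
have /andP[f1 f2] := floor_itv (ln y / ln L).
set f := Num.floor _ in f1 f2; exists (- f).
have -> : L ^ (- f) * y = expR (ln y - f%:~R * ln L).
  by rewrite addrC expRD lnK // LX mulrNz mulNr.
have LE : L = expR (ln L) by rewrite lnK.
rewrite -[leLHS]expR0 ler_expR subr_ge0 -ler_pdivlMr // f1 /=.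
rewrite [ltRHS]LE ltr_expR ltrBlDl -[X in _ + X]mul1r -mulrDl -ltr_pdivrMr //.
by move: f2; rewrite intrD.
Qed.

Lemma scale_pair (R : realType) (t : R) (w : R * R) :
  t *: (w : R^o * R^o) = (t * w.1, t * w.2) :> R * R.
Proof. by []. Qed.

Section Arithmetic.
Variables (R : realType) (K : fieldExtType rat).
Variables (iota : {rmorphism K -> R}) (sigma : {rmorphism K -> K}) (lambda : K).
Hypothesis hK : \dim {: K} = 2%N.
Hypothesis hPID : OK_pid K.
Hypothesis hsigma : nontrivial_automorphism sigma.
Hypothesis hlambda : fundamental_unit iota lambda.
Hypothesis hHam : hammarhjelm_condition iota sigma lambda.
Local Notation OK := (@ringOfIntegers K).
Local Notation N := (absnorm sigma iota).

Lemma dvd_eqnorm x y : OK x -> y != 0 -> OK_dvd x y -> N x = N y -> OK_dvd y x.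
Proof.
move=> Ox y0 [c Oc yE] Nxy.
have c0 : c != 0 by apply: contraNneq y0 => c0; rewrite yE c0 mul0r.
have [_ _ OcV] : OK_unit c.
  apply/(unit_absnorm hK hsigma iota Oc).
  have Nx0 : N x != 0.
    by rewrite absnorm_eq0; apply: contraNneq y0 => x0; rewrite yE x0 mulr0.
  by apply: (mulIf Nx0); rewrite -absnormM -yE mul1r.
by exists c^-1 => //; rewrite yE mulKf.
Qed.

Lemma bezout a b : OK a -> OK b -> exists g u v,
  [/\ OK g, OK u & OK v] /\ [/\ g = u * a + v * b, OK_dvd g a & OK_dvd g b].
Proof.
move=> Oa Ob.
pose I := [set z | exists u v, [/\ OK u, OK v & z = u * a + v * b]].
have [] := hPID (I := I).
  split.
  - by move=> z [u [v [ Ou Ov ->]]]; apply: OKD; apply: OKM.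
  - by exists 0, 0; split; [exact: OK0|exact: OK0|ring].
  - move=> x y [u [v [ Ou Ov ->]]] [u' [v' [ Ou' Ov' ->]]].
    by exists (u + u'), (v + v'); split; [exact: OKD|exact: OKD|ring].
  - move=> c x Oc [u [v [ Ou Ov ->]]].
    by exists (c * u), (c * v); split; [exact: OKM|exact: OKM|ring].
move=> g Og IE.
have [u [v [ Ou Ov gE]]] : I g by rewrite IE; exists 1; [exact: OK1|rewrite mul1r].
have [a' Oa' aE] : [set c * g | c in OK] a.
  by rewrite -IE; exists 1, 0; split; [exact: OK1|exact: OK0|ring].
have [b' Ob' bE] : [set c * g | c in OK] b.
  by rewrite -IE; exists 0, 1; split; [exact: OK0|exact: OK1|ring].
by exists g, u, v; split; split => //; [exists a'|exists b'].
Qed.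

(** A non-unit divisor of least norm is prime: its greatest common divisor with any
integer is a unit or one of its associates. *)
Lemma prime_divisor c : OK c -> c != 0 -> ~ OK_unit c ->
  exists2 p, OK_prime p & OK_dvd p c.
Proof.
move=> Oc c0 nuc.
pose P n := `[< exists p, [/\ OK p, p != 0, ~ OK_unit p, OK_dvd p c & N p = n%:R] >].
have exP : exists n, P n.
  have [n nE] := absnorm_nat hK hsigma iota Oc.
  exists n; apply/asboolP; exists c; split => //.
  by exists 1; [exact: OK1 | rewrite mul1r].
case: (ex_minnP exP) => n /asboolP[p [ Op p0 nup [d Od cE] Npn]] nmin.
exists p; last by exists d.
split=> // a b Oa Ob [e Oe abE].
have [g [u [v [[ Og Ou Ov] [gE [h Oh pE] [f Of aE]]]]]] := bezout Op Oa.
have g0 : g != 0 by apply: contraNneq p0 => g0; rewrite pE g0 mulr0.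
have [ug|nug] := pselect (OK_unit g).
  right; have [_ _ OgV] := ug.
  exists (g^-1 * (u * b + v * e)).
    by apply: OKM => //; apply: OKD; apply: OKM.
  apply: (mulfI g0); rewrite -[in RHS]mulrA mulVKf // {1}gE mulrDl -!mulrA abE.
  by rewrite mulrDl -!mulrA [p * b]mulrC.
left.
have [k Nk] := absnorm_nat hK hsigma iota Og.
have : P k.
  apply/asboolP; exists g; split => //.
  by exists (d * h); [exact: OKM|rewrite cE pE mulrA].
move=> /nmin; rewrite -(ler_nat R) -Nk -Npn => Npg.
have Ngp : N g = N p.
  apply/eqP; rewrite eq_le Npg andbT pE absnormM ler_peMl ?normr_ge0 //.
  apply: (absnorm_ge1 hK hsigma) => //.
  by apply: contraNneq p0 => h0; rewrite pE h0 mul0r.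
have [m Om ->] : OK_dvd p a.
  have [r Or gE'] : OK_dvd p g by apply: dvd_eqnorm => //; exists h.
  by exists (f * r); [exact: OKM|rewrite aE gE' mulrA].
by exists m.
Qed.

Lemma prime_dvd_sym (p q : K) : OK_prime p -> OK_prime q -> OK_dvd p q -> OK_dvd q p.
Proof.
move=> [ Op p0 nup _] [ Oq q0 nuq qP] [c Oc qE].
have [] := qP c p Oc Op; first by exists 1; [exact: OK1|rewrite mul1r -qE].
  move=> [d Od cE]; exfalso; apply: nup.
  split => //; suff -> : p^-1 = d by [].
  apply: (mulIf p0); rewrite mulVf //; apply: (mulIf q0).
  by rewrite mul1r -mulrA [p * q]mulrC mulrA -cE -qE.
by [].
Qed.

Lemma unit_lambdaX (i : int) : OK_unit (lambda ^ i).
Proof. by apply/(proj2 hlambda); exists i; left. Qed.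

Lemma unit_lambda : OK_unit lambda.
Proof. by rewrite -[lambda]expr1z; apply: unit_lambdaX. Qed.

Lemma OK_lambda : OK lambda.
Proof. by case: unit_lambda. Qed.

Lemma iota_lambda_gt0 : 0 < iota lambda.
Proof. by apply: lt_trans (proj1 hlambda). Qed.

Lemma sigma_lambda : `|iota (sigma lambda)| = (iota lambda)^-1.
Proof.
have := (unit_absnorm hK hsigma iota OK_lambda).1 unit_lambda.
rewrite /absnorm normrM gtr0_norm ?iota_lambda_gt0 // => h.
have l0 : iota lambda != 0 by rewrite gt_eqF // iota_lambda_gt0.
by apply: (mulfI l0); rewrite h divff.
Qed.

Lemma unit_normalize x : x != 0 ->
  exists2 u, OK_unit u & 1 <= iota (u * x) < iota lambda.
Proof.
move=> x0; have xp : 0 < `|iota x| by rewrite normr_gt0 fmorph_eq0.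
have [k kP] := expz_bracket (proj1 hlambda) xp.
have iX : iota (lambda ^ k) = iota lambda ^ k by rewrite fmorphXz.
have [xp'|xn] := ltP 0 (iota x).
  exists (lambda ^ k); first exact: unit_lambdaX.
  by rewrite rmorphM iX -[iota x]gtr0_norm.
exists (- lambda ^ k); first by apply/(proj2 hlambda); exists k; right.
by rewrite mulNr rmorphN rmorphM iX -mulrN -[- iota x]ler0_norm.
Qed.

Lemma prime_unitM (u p : K) : OK_unit u -> OK_prime p -> OK_prime (u * p).
Proof.
move=> [u0 Ou OV] [ Op p0 nup pP]; split.
- exact: OKM.
- by rewrite mulf_neq0.
- move=> [_ _ Oup]; apply: nup; split => //.
  by rewrite -[p^-1](mulVKf u0) -invfM; apply: OKM.
move=> a b Oa Ob [c Oc abE].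
have dvdu z : OK_dvd p z -> OK_dvd (u * p) z.
  by move=> [d Od ->]; exists (d * u^-1); [exact: OKM|rewrite -mulrA mulKf].
have [] := pP a b Oa Ob; last 2 first.
- by move=> /dvdu; left.
- by move=> /dvdu; right.
by exists (c * u); [exact: OKM|rewrite abE mulrA].
Qed.

(** Normalized into the interval from [1] to [lambda], a prime is subject to the
Hammarhjelm condition. *)
Lemma prime_normalize p : OK_prime p -> exists2 u, OK_unit u &
  [/\ OK_prime (u * p), 1 < iota (u * p), iota (u * p) < iota lambda &
      1 < `|iota (sigma (u * p))|].
Proof.
move=> pp; have [_ p0 _ _] := pp.
have [u uu /andP[l1 l2]] := unit_normalize p0.
have pup := prime_unitM uu pp; exists u => //.
have l1' : 1 < iota (u * p).
  rewrite lt_neqAle l1 andbT; apply/eqP => up1.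
  have : u * p = 1 by apply: (fmorph_inj iota); rewrite -up1 rmorph1.
  case: pup => _ _ nu _ up; apply: nu; rewrite up.
  by split; rewrite ?oner_eq0 ?invr1 //; apply: OK1.
by split => //; apply: hHam.
Qed.

(** The Hammarhjelm condition passes from primes to all integers by induction on
the norm: a normalized prime factor is split off, and the cofactor is brought back
above [1] by at most one factor [lambda], which has conjugate of absolute value
[lambda ^ -1]. *)
Lemma hammarhjelm_integer c : OK c -> 1 <= `|iota c| -> `|iota c| < iota lambda ->
  1 <= `|iota (sigma c)|.
Proof.
move=> Oc0; have [n] := absnorm_nat hK hsigma iota Oc0.
elim/ltn_ind: n c Oc0 => n IH c Oc Nc c1 cl.
have c0 : c != 0.
  by rewrite -(fmorph_eq0 iota) -normr_gt0; apply: lt_le_trans c1.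
have l0 := iota_lambda_gt0.
have [uc|nuc] := pselect (OK_unit c).
  have /(proj2 hlambda)[i ci] := uc.
  have cE : `|iota c| = iota lambda ^ i.
    by case: ci => ->; rewrite ?rmorphN ?normrN fmorphXz ger0_norm // exprz_ge0 // ltW.
  have i0 : i = 0.
    have l1 := proj1 hlambda.
    have := c1; rewrite cE -[leLHS](expr0z (iota lambda)) ler_eXz2l // => i0.
    have := cl; rewrite cE -[ltRHS](expr1z (iota lambda)) ltr_eXz2l // => i1.
    by apply/eqP; rewrite eq_le i0 andbT -ltzD1 add0r.
  by move: ci; rewrite i0 expr0z => -[] ->; rewrite ?rmorphN ?normrN !rmorph1 normr1.
have [p pp [d Od cE]] := prime_divisor Oc c0 nuc.
have [u [u0 Ou OV] [[ Oq q0 nuq _] q1 ql sq1]] := prime_normalize pp.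
set q := u * p in Oq q0 nuq q1 ql sq1.
have Oe : OK (d * u^-1) by apply: OKM.
have cqE : c = d * u^-1 * q by rewrite /q -mulrA mulKf.
move: (d * u^-1) Oe cqE => e Oe cqE.
have e0 : e != 0 by apply: contraNneq c0 => e0; rewrite cqE e0 mul0r.
have [m Nm] := absnorm_nat hK hsigma iota Oe.
have Nq : 1 < N q.
  rewrite lt_neqAle absnorm_ge1 // andbT; apply/eqP => /esym.
  by move/(unit_absnorm hK hsigma iota Oq).
have Ne0 : 0 < N e by rewrite lt_neqAle eq_sym absnorm_eq0 e0 normr_ge0.
have mn : (m < n)%N.
  by rewrite -(ltr_nat R) -Nm -Nc cqE absnormM ltr_pMr.
have ec : `|iota c| = `|iota e| * iota q.
  by rewrite cqE rmorphM normrM [X in _ * X]gtr0_norm // (lt_trans _ q1).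
have sc : `|iota (sigma c)| = `|iota (sigma e)| * `|iota (sigma q)|.
  by rewrite cqE !rmorphM normrM.
suff se : 1 <= `|iota (sigma e)| by rewrite sc mulr_ege1 // ltW.
have el : `|iota e| < iota lambda.
  by apply: le_lt_trans cl; rewrite ec ler_peMr // ltW.
have [e1|e1] := leP 1 `|iota e|; first exact: (IH m).
have Nle : N (lambda * e) = m%:R.
  rewrite absnormM Nm.
  by rewrite ((unit_absnorm hK hsigma iota OK_lambda).1 unit_lambda) mul1r.
have ile : `|iota (lambda * e)| = iota lambda * `|iota e|.
  by rewrite rmorphM normrM gtr0_norm.
have Ole : OK (lambda * e) by apply: OKM => //; case: unit_lambda.
have := IH m mn _ Ole Nle; rewrite ile.
have le1 : 1 <= iota lambda * `|iota e|.
  rewrite (le_trans c1) // ec mulrC ler_wpM2r // ltW //.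
have le2 : iota lambda * `|iota e| < iota lambda by rewrite gtr_pMr.
move=> /(_ le1 le2); rewrite !rmorphM normrM sigma_lambda mulrC ler_pdivlMr //.
by rewrite mul1r => h; apply: le_trans h; apply: ltW (proj1 hlambda).
Qed.

Definition primitive (x : K * K) :=
  forall p, OK_prime p -> ~ (OK_dvd p x.1 /\ OK_dvd p x.2).

(** The greatest common divisor of the entries has no prime divisor, so it is a
unit. *)
Lemma primitive_bezout x : OK x.1 -> OK x.2 -> x != 0 -> primitive x ->
  exists u v, [/\ OK u, OK v & u * x.1 + v * x.2 = 1].
Proof.
move=> O1 O2 x0 px.
have [g [u [v [[ Og Ou Ov] [gE [a Oa x1E] [b Ob x2E]]]]]] := bezout O1 O2.
have g0 : g != 0.
  apply: contraNneq x0 => g0; rewrite g0 !mulr0 in x1E x2E.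
  by case: x x1E x2E {O1 O2 px gE} => x1 x2 /= -> ->.
have [_ _ OV] : OK_unit g.
  apply: contrapT => nug; have [p pp [c Oc gcE]] := prime_divisor Og g0 nug.
  apply: (px p pp); split.
    by exists (a * c); [exact: OKM|rewrite x1E gcE mulrA].
  by exists (b * c); [exact: OKM|rewrite x2E gcE mulrA].
exists (g^-1 * u), (g^-1 * v); split; [exact: OKM|exact: OKM|].
by rewrite -!mulrA -mulrDr -gE mulVf.
Qed.

Variable W : set (R * R).
Hypothesis Wstar : forall t w, `|t| <= 1 -> W w -> W (t * w.1, t * w.2).

Definition iota2 (x : K * K) : R * R := (iota x.1, iota x.2).
Definition sigma2 (x : K * K) : R * R := (iota (sigma x.1), iota (sigma x.2)).

Lemma iota2_inj : injective iota2.
Proof. by move=> [a b] [c d] [/fmorph_inj -> /fmorph_inj ->]. Qed.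

(** A prime factor [p] of [x], normalized so that [1 < iota p], has
[1 < |sigma p|], so [p^-1 x] stays in the star-shaped window and hides [x]; so does
[lambda^-1 x] when [lambda * sigma x] is in the window.  For primitive [x] these are
the only obstructions: any competitor is [b x] with [b] an integer by unimodularity
of [x], and [lambda b] is excluded by [hammarhjelm_integer]. *)
Lemma visible_primitive : visible (cut_and_project W (minkowski_lattice iota sigma)) =
  iota2 @` [set x | [/\ OK x.1, OK x.2, primitive x, W (sigma2 x) &
    ~ W (iota lambda * (sigma2 x).1, iota lambda * (sigma2 x).2)]].
Proof.
have l0 := iota_lambda_gt0; have l1 := proj1 hlambda.
have [ln0 Ol OlV] := unit_lambda.
apply/seteqP; split => y.
  move=> [[y4 [[x [ O1 O2] <-] Wx] <-] y0 vis]; rewrite /= in O1 O2 Wx y0 vis.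
  exists x => //=; split => //.
    move=> p pp [[a Oa aE] [b Ob bE]].
    have [u [u0 Ou OV] [[ Oq q0 _ _] q1 ql sq1]] := prime_normalize pp.
    set q := u * p in Oq q0 q1 ql sq1.
    have q00 : 0 < iota q by apply: lt_trans q1.
    have aE' : a * u^-1 = x.1 / q by apply: (mulIf q0); rewrite mulfVK // aE /q -mulrA mulKf.
    have bE' : b * u^-1 = x.2 / q by apply: (mulIf q0); rewrite mulfVK // bE /q -mulrA mulKf.
    clearbody q; apply: (vis (iota q)^-1); rewrite ?invr_gt0 ?invf_lt1 //.
    exists ((iota (x.1 / q), iota (x.2 / q)),
            (iota (sigma (x.1 / q)), iota (sigma (x.2 / q)))).
      split; first by exists (x.1 / q, x.2 / q); rewrite //= -aE' -bE'; split; apply: OKM.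
      rewrite /= !rmorphM !fmorphV ![_ * (iota (sigma q))^-1]mulrC.
      apply: (Wstar (w := (_, _))) => //.
      by rewrite normfV invf_le1 ?(lt_trans _ sq1) // ltW.
    by rewrite scale_pair /= !rmorphM !fmorphV ![_ / _]mulrC.
  move=> Wl; apply: (vis (iota lambda)^-1); rewrite ?invr_gt0 ?invf_lt1 //.
  exists ((iota (lambda^-1 * x.1), iota (lambda^-1 * x.2)),
          (iota (sigma (lambda^-1 * x.1)), iota (sigma (lambda^-1 * x.2)))).
    split; first by exists (lambda^-1 * x.1, lambda^-1 * x.2) => //=; split; apply: OKM.
    have := Wstar (t := (iota lambda * iota (sigma lambda))^-1) _ Wl.
    rewrite normfV normrM sigma_lambda gtr0_norm // divff ?gt_eqF // invr1 => /(_ (lexx _)).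
    rewrite /= invfM !rmorphM !fmorphV.
    rewrite ![(iota lambda)^-1 * (_^-1)]mulrC.
    by rewrite -!mulrA !mulKf // ?gt_eqF // fmorph_eq0.
  by rewrite scale_pair /= !rmorphM !fmorphV.
move=> [x [ O1 O2 px Wx nWx] <-].
have x0 : x != 0.
  apply/eqP => x0; apply: nWx; move: Wx.
  by rewrite /sigma2 x0 /= !rmorph0 mulr0.
have [u [v [ Ou Ov uvE]]] := primitive_bezout O1 O2 x0 px.
split.
- by exists (iota2 x, sigma2 x) => //; split => //; exists x.
- apply: contraNneq x0 => e0; case: e0 => h1 h2.
  move: h1 h2 => /eqP; rewrite fmorph_eq0 => /eqP h1 /eqP.
  rewrite fmorph_eq0 => /eqP h2.
  by case: x h1 h2 {O1 O2 px Wx nWx uvE} => x1 x2 /= -> ->.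
move=> t t0 t1 [y4 [[z [ Oz1 Oz2] <-] Wz] zE].
move: zE; rewrite scale_pair /= => -[z1E z2E].
pose b := u * z.1 + v * z.2.
have Ob : OK b by apply: OKD; apply: OKM.
have ib : iota b = t.
  rewrite /b rmorphD !rmorphM z1E z2E.
  rewrite mulrCA [_ * (t * _)]mulrCA -mulrDr -!rmorphM -rmorphD uvE rmorph1 mulr1 //.
have z1b : z.1 = b * x.1 by apply: (fmorph_inj iota); rewrite rmorphM ib.
have z2b : z.2 = b * x.2 by apply: (fmorph_inj iota); rewrite rmorphM ib.
have b0 : b != 0 by rewrite -(fmorph_eq0 iota) ib gt_eqF.
have sb0 : 0 < `|iota (sigma b)| by rewrite normr_gt0 !fmorph_eq0.
have sbl : `|iota (sigma b)| < iota lambda.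
  rewrite ltNge; apply/negP => lb; apply: nWx.
  have := Wstar (t := iota lambda / iota (sigma b)) _ Wz.
  rewrite normrM normfV gtr0_norm // ler_pdivrMr // mul1r => /(_ lb).
  rewrite /= z1b z2b !rmorphM -!mulrA !mulKf //; by rewrite !fmorph_eq0.
have Nb := absnorm_ge1 hK hsigma iota Ob b0.
have lbE : `|iota (lambda * b)| = iota lambda * t by rewrite rmorphM ib normrM !gtr0_norm.
have slbE : `|iota (sigma (lambda * b))| = `|iota (sigma b)| / iota lambda.
  by rewrite !rmorphM normrM sigma_lambda mulrC.
have lb1 : 1 <= iota lambda * t.
  apply: le_trans Nb _; rewrite /absnorm normrM ib gtr0_norm // mulrC.
  by rewrite ler_wpM2r // ltW.
have := hammarhjelm_integer (OKM Ol Ob); rewrite lbE slbE.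
rewrite gtr_pMr // => /(_ lb1 t1).
by rewrite ler_pdivlMr // mul1r leNgt sbl.
Qed.

End Arithmetic.

(** * Euler products over the prime elements *)

Section PrimeSystem.
Variables (R : realType) (K : fieldExtType rat).
Variables (iota : {rmorphism K -> R}) (sigma : {rmorphism K -> K}) (lambda : K).
Hypothesis hK : \dim {: K} = 2%N.
Hypothesis hsigma : nontrivial_automorphism sigma.
Hypothesis hlambda : fundamental_unit iota lambda.
Hypothesis hHam : hammarhjelm_condition iota sigma lambda.
Local Notation OK := (@ringOfIntegers K).
Local Notation N := (absnorm sigma iota).

Lemma absnorm_unit u : OK_unit u -> N u = 1.
Proof. by move=> uu; apply/(unit_absnorm hK hsigma) => //; case: uu. Qed.

Lemma absnorm_prime_ge2 p : OK_prime p -> 2 <= N p.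
Proof.
move=> [Op p0 nup _]; have [n nE] := absnorm_nat hK hsigma iota Op.
have : N p <> 1 by move=> /(unit_absnorm hK hsigma iota Op).
have := absnorm_ge1 hK hsigma iota Op p0.
by rewrite nE (ler_nat _ 1) (ler_nat _ 2) => n1 n2; case: n n1 n2 {nE} => [|[]].
Qed.

(** Up to sign, the product of a prime with its conjugate depends only on the norm.
So a prime of norm [n] divides [p * sigma p] for any other such [p], and is
associated to [p] or to [sigma p]. *)
Lemma primes_of_norm (n : nat) : exists t : seq K,
  [/\ (size t <= 2)%N,
      forall p, p \in t -> [/\ OK_prime p, 0 < iota p & N p = n%:R],
      pairwise (fun p q => ~~ `[< OK_dvd q p >]) t &
      forall r, OK_prime r -> N r = n%:R -> exists2 p, p \in t & OK_dvd p r].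
Proof.
have pos p : OK_prime p -> N p = n%:R -> exists p', [/\ OK_prime p', 0 < iota p',
    N p' = n%:R & OK_dvd p' p].
  move=> pp Np; have [u uu [pup up1 _ _]] := prime_normalize hlambda hHam pp.
  exists (u * p); split => //; first exact: lt_trans up1.
    by rewrite absnormM (absnorm_unit uu) mul1r.
  by case: uu => u0 _ OV; exists u^-1 => //; rewrite mulKf.
have dvdT x y z : OK_dvd x y -> OK_dvd y z -> OK_dvd x z.
  by move=> [a Oa ->] [b Ob ->]; exists (b * a); [exact: OKM|rewrite mulrA].
have conj p r : OK_prime p -> OK_prime r -> N p = n%:R -> N r = n%:R ->
    ~ OK_dvd p r -> OK_dvd r (sigma p) /\ OK_dvd (sigma p) r.
  move=> pp pr Np Nr pr'; have [Op p0 _ _] := pp; have [Or r0 _ rP] := pr.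
  have Osp := OK_sigma sigma Op; have Osr := OK_sigma sigma Or.
  have [a aE] := norm_int hK hsigma Op; have [b bE] := norm_int hK hsigma Or.
  have dr : OK_dvd r (p * sigma p).
    have nab : `|a| = `|b|.
      apply/eqP; rewrite -(eqr_int R) !intr_norm -!(rmorph_int iota) -aE -bE.
      by rewrite !rmorphM; apply/eqP; rewrite -[LHS]/(N p) Np -Nr.
    have : (a == b) || (a == - b).
      by rewrite -eqf_sqr -(real_normK (num_real a)) nab real_normK ?num_real.
    rewrite aE => /orP[]/eqP ->.
      by exists (sigma r) => //; rewrite -bE mulrC.
    by exists (- sigma r); [exact: OKN|rewrite mulrNz -bE mulNr mulrC].
  have [|] := rP _ _ Op Osp dr.
    by move=> /(prime_dvd_sym pr pp).
  move=> rsp; split => //; apply: (dvd_eqnorm hK hsigma (iota := iota)) => //.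
    by rewrite fmorph_eq0.
  by rewrite absnorm_sigma // Np.
have [[p0 [pp0 Np0]]|none] := pselect (exists p, OK_prime p /\ N p = n%:R); last first.
  by exists [::]; split => // r pr Nr; exfalso; apply: none; exists r.
have [p [pp ip Np _]] := pos _ pp0 Np0.
have [[q0 [pq0 Nq0 pq0']]|all_p] :=
    pselect (exists q, [/\ OK_prime q, N q = n%:R & ~ OK_dvd p q]); last first.
  exists [:: p]; split => //; first by move=> q; rewrite inE => /eqP ->.
  move=> r pr Nr; exists p; first by rewrite inE.
  by apply: contrapT => npr; apply: all_p; exists r.
have [q [pq iq Nq qq0]] := pos _ pq0 Nq0.
have npq : ~ OK_dvd p q by move=> pq'; apply: pq0'; apply: dvdT qq0.
exists [:: p; q]; split => //.
- by move=> x; rewrite !inE => /orP[/eqP ->|/eqP ->].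
- rewrite /= !andbT; apply/asboolPn => qp.
  by apply: npq; apply: prime_dvd_sym.
move=> r pr Nr; have [dpr|npr] := pselect (OK_dvd p r).
  by exists p; rewrite ?inE ?eqxx.
exists q; first by rewrite !inE eqxx orbT.
have [_ spr] := conj _ _ pp pr Np Nr npr.
by have [qsp _] := conj _ _ pp pq Np Nq npq; apply: dvdT spr.
Qed.

(** Division by [p] shrinks the size [sqrt (a * b)] of a pair of windows by this
factor. *)
Definition weight (p : K) : R := (Num.sqrt (N p))^-1.

Lemma weight_gt0 p : p != 0 -> 0 < weight p.
Proof.
by move=> p0; rewrite invr_gt0 sqrtr_gt0 lt_neqAle eq_sym absnorm_eq0 p0 normr_ge0.
Qed.

Lemma weight_prime_le1 p : OK_prime p -> weight p <= 1.
Proof.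
move=> pp; rewrite invf_le1; last by rewrite sqrtr_gt0 (lt_le_trans _ (absnorm_prime_ge2 pp)).
by rewrite -sqrtr1 ler_wsqrtr // (le_trans _ (absnorm_prime_ge2 pp)) // ler1n.
Qed.

(** Comparison of [n ^ (- 3 / 2)] with a telescoping difference, for the convergence
of its sum. *)
Lemma inv_sqrt3_telescope (n : nat) :
  (Num.sqrt n.+2%:R)^-1 ^+ 3 <=
  2 * ((Num.sqrt n.+1%:R)^-1 - (Num.sqrt n.+2%:R)^-1) :> R.
Proof.
set a := Num.sqrt n.+1%:R; set b := Num.sqrt n.+2%:R.
have a0 : 0 < a by rewrite sqrtr_gt0.
have b0 : 0 < b by rewrite sqrtr_gt0.
have ab : a <= b by rewrite ler_wsqrtr // ler_nat.
have ab1 : b ^+ 2 - a ^+ 2 = 1 by rewrite !sqr_sqrtr // -natrB // subSnn.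
have -> : a^-1 - b^-1 = (a * b * (a + b))^-1.
  have abn0 : a + b != 0 by rewrite gt_eqF // addr_gt0.
  have e : b - a = (a + b)^-1 by apply: (mulIf abn0); rewrite mulVf // -ab1; ring.
  rewrite [RHS]invfM -e.
  by field; rewrite !gt_eqF.
rewrite exprVn ler_pdivlMr; last by rewrite !mulr_gt0 // addr_gt0.
rewrite mulrC ler_pdivrMr ?exprn_gt0 //.
have -> : 2 * b ^+ 3 = b * b * (b + b) by ring.
have [a0' b0'] := (ltW a0, ltW b0).
by apply: ler_pM; rewrite ?mulr_ge0 ?addr_ge0 ?ler_wpM2r ?lerD2r.
Qed.

(** Listing the primes by norm, at most two of norm [n] up to units, bounds the Euler
product at exponent [3 / 2] by the exponential of twice the sum of the
[n ^ (- 3 / 2)].  The factors at exponent [2] lie between [0] and [1], so the partial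
products decrease to a limit. *)
Lemma prime_sequence : exists s : nat -> seq K,
  [/\ forall Q p, p \in s Q -> OK_prime p /\ 0 < iota p,
      forall Q, pairwise (fun p q => ~~ `[< OK_dvd q p >]) (s Q),
      forall Q r, OK_prime r -> N r < Q%:R -> exists2 p, p \in s Q & OK_dvd p r,
      exists M, forall Q, \prod_(p <- s Q) (1 + weight p ^+ 3) <= M &
      exists l : R, (fun Q => \prod_(p <- s Q) (1 - weight p ^+ 4)) @ \oo --> l].
Proof.
have [t tP] := choice primes_of_norm.
pose s := fix s n := if n is m.+1 then t m ++ s m else [::].
have sP Q p : p \in s Q -> [/\ OK_prime p, 0 < iota p & N p < Q%:R].
  elim: Q => //= Q IH; rewrite mem_cat => /orP[|/IH].
    by case: (tP Q) => _ /[swap] _ /[swap] _ /[apply] -[pp ip ->]; rewrite ltr_nat.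
  by move=> [pp ip pQ]; split => //; apply: lt_trans pQ _; rewrite ltr_nat.
have w01 p : OK_prime p -> 0 <= weight p <= 1.
  move=> pp; rewrite weight_prime_le1 // andbT ltW // weight_gt0 //.
  by case: pp.
exists s; split.
- by move=> Q p /sP[].
- elim=> //= Q IH; rewrite pairwise_cat IH andbT.
  have [_ tN tpw _] := tP Q; rewrite tpw andbT.
  apply/allrelP => p q /tN[pp _ Np] /sP[pq _ Nq].
  apply/asboolPn => dqp; have dpq := prime_dvd_sym pq pp dqp.
  move: Nq; rewrite -Np => /lt_geF/negP; apply.
  have [[Oq q0 _ _] [Op p0 _ _]] := (pq, pp); case: dpq => c Oc qE.
  rewrite qE absnormM ler_peMl ?normr_ge0 // absnorm_ge1 //.
  by apply: contraNneq q0 => c0; rewrite qE c0 mul0r.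
- move=> Q r pr; elim: Q => [|Q IH].
    by rewrite ltNge normr_ge0.
  have [m mE] := absnorm_nat hK hsigma iota (let: And4 a _ _ _ := pr in a).
  rewrite mE ltr_nat ltnS leq_eqVlt => /orP[/eqP mQ|mQ].
    have [_ _ _ /(_ r pr)] := tP Q; rewrite mE mQ => /(_ erefl)[p pt dpr].
    by exists p; rewrite //= mem_cat pt.
  have [|p ps dpr] := IH; first by rewrite mE ltr_nat.
  by exists p; rewrite //= mem_cat ps orbT.
- have tw n p : p \in t n -> weight p = (Num.sqrt n%:R)^-1.
    by case: (tP n) => _ tN _ _ /tN[_ _ Np]; rewrite /weight Np.
  have t2 n : (n < 2)%N -> t n = [::].
    move=> n2; case: (tP n) => _ tN _ _; case: (t n) tN => // p t' /(_ p).
    rewrite inE eqxx => /(_ isT)[/absnorm_prime_ge2 + _ Np].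
    by rewrite Np ler_nat leqNgt n2.
  have tb n : \prod_(p <- t n.+2) (1 + weight p ^+ 3) <=
      expR (2 * (Num.sqrt n.+2%:R)^-1 ^+ 3).
    set c := _ ^+ 3.
    have c0 : 0 <= c by rewrite exprn_ge0 // invr_ge0 sqrtr_ge0.
    have -> : \prod_(p <- t n.+2) (1 + weight p ^+ 3) = (1 + c) ^+ size (t n.+2).
      transitivity (\prod_(p <- t n.+2) (1 + c)).
        by apply: eq_big_seq => p /tw ->.
      by rewrite big_const_seq count_predT iter_mulr mulr1.
    have [ts _ _ _] := tP n.+2.
    apply: (le_trans (y := (1 + c) ^+ 2)).
      by rewrite ler_weXn2l // lerDl.
    by rewrite expRM_natl ler_pXn2r ?nnegrE ?addr_ge0 ?expR_ge0 // expR_ge1Dx.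
  (* Twice the constant [2] of the telescoping bound, since each norm contributes at
  most two primes; there are none of norm less than [2]. *)
  have bnd n : \prod_(p <- s n.+2) (1 + weight p ^+ 3) <=
      expR (4 * (1 - (Num.sqrt n.+1%:R)^-1)).
    elim: n => [|n IH]; first by rewrite /= !t2 // big_nil sqrtr1 invr1 subrr mulr0 expR0.
    rewrite [s _]/= big_cat /=.
    apply: (le_trans (ler_pM _ _ (tb n) IH)).
    + rewrite big_seq prodr_ge0 // => p pt; rewrite addr_ge0 // exprn_ge0 //.
      by case: (tP n.+2) => _ /(_ _ pt)[/w01/andP[]].
    + rewrite big_seq prodr_ge0 // => p pt; rewrite addr_ge0 // exprn_ge0 //.
      by have [/w01/andP[]] := sP _ _ pt.
    rewrite -expRD ler_expR; have := inv_sqrt3_telescope n; lra.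
  have e1 : 1 <= expR 4 :> R by rewrite -[leLHS]expR0 ler_expR.
  exists (expR 4) => -[|[|Q]]; [by rewrite big_nil|by rewrite /= t2 ?big_nil|].
  apply: le_trans (bnd Q) _; rewrite ler_expR ler_piMr ?gerBl ?invr_ge0 ?sqrtr_ge0 //.
pose f Q := \prod_(p <- s Q) (1 - weight p ^+ 4).
have fac p : OK_prime p -> 0 <= 1 - weight p ^+ 4 <= 1.
  move=> /w01/andP[w0 w1]; rewrite subr_ge0 exprn_ile1 //= gerBl exprn_ge0 //.
have f0 Q : 0 <= f Q.
  by rewrite /f big_seq prodr_ge0 // => p /sP[/fac/andP[]].
have fdec : nonincreasing_seq f.
  apply/nonincreasing_seqP => Q; rewrite /f /= big_cat /= ler_piMl ?f0 //.
  rewrite big_seq prodr_ile1 // => p; case: (tP Q) => _ tN _ _ /tN[/fac].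
  by [].
have /cvg_ex[l fl] : cvgn f.
  by apply: nonincreasing_is_cvgn => //; exists 0 => _ [Q _ <-].
by exists l.
Qed.

End PrimeSystem.

(** * Lebesgue measure under affine maps *)

Section PlaneTopology.
Variable R : realType.
Implicit Types (A : set (R * R)) (c y : R * R) (e s : R).

Definition box c e : set (R * R) := [set y | `|y.1 - c.1| < e /\ `|y.2 - c.2| < e].

Lemma interior_boxP A c : interior A c <-> exists2 e, 0 < e & box c e `<=` A.
Proof.
split.
  move=> /nbhs_ballP[e /= e0 eA]; exists e => // y [y1 y2]; apply: eA.
  by split; rewrite /ball /= distrC.
move=> [e e0 eA]; apply/nbhs_ballP; exists e => // y [y1 y2]; apply: eA.
by split; rewrite distrC.
Qed.

Lemma closure_boxP A c : closure A c <-> forall e, 0 < e -> exists2 y, A y & box c e y.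
Proof.
split.
  move=> cA e e0; have : nbhs c (box c e).
    by apply/interior_boxP; exists e.
  by move=> /cA[y [Ay cy]]; exists y.
move=> H B /interior_boxP[e e0 eB]; have [y Ay cy] := H e e0.
by exists y; split => //; apply: eB.
Qed.

Lemma open_boxP A : (forall c, A c -> exists2 e, 0 < e & box c e `<=` A) -> open A.
Proof.
move=> H; rewrite openE => c /H[e e0 eA]; apply/interior_boxP; by exists e.
Qed.

(** There are countably many boxes with rational centres and radii [1 / n]. *)
Lemma open_bigcup_boxes A : open A ->
  A = \bigcup_(q : rat * rat * nat) (if `[< box (ratr q.1.1, ratr q.1.2) q.2.+1%:R^-1 `<=` A >]
    then box (ratr q.1.1, ratr q.1.2) q.2.+1%:R^-1 else set0).
Proof.
move=> oA; apply/seteqP; split => [y Ay|y [q _]]; last first.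
  by case: ifPn => // /asboolP qA /qA.
have /interior_boxP[e e0 eA] : interior A y by move: oA; rewrite openE; apply.
have e20 : 0 < e / 2 by rewrite divr_gt0.
pose n := Num.truncn (e / 2)^-1.
have ne : n.+1%:R^-1 < e / 2.
  by rewrite invf_plt ?posrE // truncnS_gt.
have n0 : 0 < n.+1%:R^-1 :> R by rewrite invr_gt0.
have [q1 /andP[q1l q1r]] : exists q, (y.1 - n.+1%:R^-1 < ratr q < y.1 + n.+1%:R^-1)%R.
  have [|q] := @rat_in_itvoo R (y.1 - n.+1%:R^-1) (y.1 + n.+1%:R^-1); first by rewrite ltrD2l gtrN.
  by rewrite in_itv => q1; exists q.
have [q2 /andP[q2l q2r]] : exists q, (y.2 - n.+1%:R^-1 < ratr q < y.2 + n.+1%:R^-1)%R.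
  have [|q] := @rat_in_itvoo R (y.2 - n.+1%:R^-1) (y.2 + n.+1%:R^-1); first by rewrite ltrD2l gtrN.
  by rewrite in_itv => q2; exists q.
exists (q1, q2, n) => //=; move: (n.+1%:R^-1) ne n0 q1l q1r q2l q2r => r *.
rewrite asboolT; first by split; rewrite /= ltr_norml; apply/andP; split; lra.
move=> z [] /=; rewrite !ltr_norml => /andP[a1 a2] /andP[b1 b2].
by apply: eA; split; rewrite ltr_norml; apply/andP; split; lra.
Qed.

Local Notation mR := (measurableTypeR R).

Lemma measurable_box c e : measurable (box c e : set (mR * mR)).
Proof.
have -> : box c e = `]c.1 - e, c.1 + e[%classic `*` `]c.2 - e, c.2 + e[%classic.
  by apply/seteqP; split => y; rewrite /box /= !in_itv /= !ltr_distl.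
by apply: measurableX; exact: measurable_itv.
Qed.

Lemma open_measurable2 A : open A -> measurable (A : set (mR * mR)).
Proof.
move=> /open_bigcup_boxes ->; apply: countable_bigcupT_measurable => // q.
by case: ifP => _; [exact: measurable_box|exact: measurable0].
Qed.

Lemma interior_measurable2 A : measurable (interior A : set (mR * mR)).
Proof. by apply: open_measurable2; exact: open_interior. Qed.

Lemma closure_measurable2 A : measurable (closure A : set (mR * mR)).
Proof.
rewrite -[X in measurable X]setCK; apply: measurableC; apply: open_measurable2.
by apply: closed_openC; exact: closed_closure.
Qed.

End PlaneTopology.

Section AffineMeasure.

Lemma push_measure d d' (T1 : measurableType d) (T2 : measurableType d')
    (R : realType) (m : {measure set T1 -> \bar R}) (f : T1 -> T2) :
  measurable_fun setT f ->
  exists nu : {measure set T2 -> \bar R}, forall X, nu X = m (f @^-1` X).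
Proof.
move=> mf; unshelve eexists (@pushforward _ _ T1 T2 R m f : {measure set T2 -> \bar R}).
  exact: mf.
by [].
Qed.

Lemma scale_measure d (T : measurableType d) (R : realType)
    (m : {measure set T -> \bar R}) (k : R) : 0 < k ->
  exists nu : {measure set T -> \bar R}, forall X, nu X = (k%:E * m X)%E.
Proof. by move=> k0; exists (mscale (PosNum k0)%:num%:nng m). Qed.

Lemma mule_cancel (R : realType) (a b c : R) (x y : \bar R) : c * (a * b) = 1 ->
  (c%:E * ((a%:E * x) * (b%:E * y)))%E = (x * y)%E.
Proof. by move=> cab; rewrite muleACA -(EFinM a b) (muleA c%:E) -(EFinM c (a * b)) cab mul1e. Qed.

(** The rescaled image of the product measure under the product map takes the right
values on rectangles, so it is the product measure by uniqueness. *)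
Lemma product_measure_map d1 d2 (T1 : measurableType d1) (T2 : measurableType d2)
    (R : realType) (m1 : {sigma_finite_measure set T1 -> \bar R})
    (m2 : {sigma_finite_measure set T2 -> \bar R}) (f1 : T1 -> T1) (f2 : T2 -> T2)
    (k1 k2 : R) : 0 < k1 -> 0 < k2 ->
  measurable_fun setT f1 -> measurable_fun setT f2 ->
  (forall X, measurable X -> m1 (f1 @^-1` X) = (k1%:E * m1 X)%E) ->
  (forall X, measurable X -> m2 (f2 @^-1` X) = (k2%:E * m2 X)%E) ->
  forall X, measurable X ->
    (m1 \x m2)%E ((fun y => (f1 y.1, f2 y.2)) @^-1` X) = ((k1 * k2)%:E * (m1 \x m2)%E X)%E.
Proof.
move=> k10 k20 mf1 mf2 E1 E2 X mX.
have mf : measurable_fun setT (fun y : T1 * T2 => (f1 y.1, f2 y.2)).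
  apply/measurable_fun_pairP; split.
    by apply: (measurableT_comp mf1); exact: measurable_fst.
  by apply: (measurableT_comp mf2); exact: measurable_snd.
have [nu nuE] := push_measure (m1 \x m2)%E mf.
have k120 : 0 < (k1 * k2)^-1 by rewrite invr_gt0 mulr_gt0.
have [nu' nu'E] := scale_measure nu k120.
rewrite [X in (_ * X)%E](product_measure_unique (m' := nu')) //.
  by rewrite nu'E nuE muleA -EFinM divff ?mul1e // mulf_neq0 // gt_eqF.
move=> A B mA mB; rewrite nu'E nuE.
have -> : (fun y : T1 * T2 => (f1 y.1, f2 y.2)) @^-1` (A `*` B) =
    (f1 @^-1` A) `*` (f2 @^-1` B) by apply/seteqP; split.
have mA' : measurable (f1 @^-1` A) by rewrite -[X in measurable X]setTI; exact: mf1.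
have mB' : measurable (f2 @^-1` B) by rewrite -[X in measurable X]setTI; exact: mf2.
have E12 := product_measure1E m1 m2 mA' mB'.
rewrite [X in (_ * X)%E](etrans E12 (congr2 mule (E1 A mA) (E2 B mB))).
by apply: mule_cancel; rewrite mulVf // mulf_neq0 // gt_eqF.
Qed.

Variable R : realType.
Local Notation mR := (measurableTypeR R).

Lemma measurable_affine (s t : R) :
  measurable_fun setT ((fun x => s * x + t) : mR -> mR).
Proof. by apply: measurable_funD => //; apply: measurable_funM. Qed.

Lemma lebesgue_affine (s t : R) (X : set mR) : 0 < s -> measurable X ->
  lebesgue_measure ((fun x => s * x + t) @^-1` X) = (s^-1%:E * lebesgue_measure X)%E.
Proof.
move=> s0 mX.
have [nu nuE] := push_measure (@lebesgue_measure R) (measurable_affine s t).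
have [nu' nu'E] := scale_measure nu s0.
rewrite [X in (_ * X)%E](lebesgue_measure_unique (mu := nu')) //.
  by rewrite nu'E nuE muleA -EFinM mulVf ?mul1e // gt_eqF.
move=> _ [[a b]] _ <-; rewrite nu'E nuE.
have -> : (fun x => s * x + t) @^-1` [set` `]a, b]] = [set` `](a - t) / s, (b - t) / s]].
  apply/seteqP; split => x /=; rewrite !in_itv /= ltr_pdivrMr // ler_pdivlMr //;
  by rewrite ltrBlDr lerBrDr [x * s]mulrC.
have E c d : @lebesgue_measure R [set` `]c, d]] = if c < d then (d - c)%:E else 0%E.
  by rewrite lebesgue_measure_itv /= lte_fin EFinB.
rewrite [X in (_ * X)%E]E [LHS]E ltr_pM2r ?invr_gt0 // ltrD2r.
case: ifP => _; last by rewrite mule0.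
by rewrite -(EFinM s); congr EFin; rewrite /=; field; rewrite gt_eqF.
Qed.

HB.instance Definition _ := Measure.on (@lebesgue2 R).

Lemma lebesgue2X (A B : set mR) : measurable A -> measurable B ->
  lebesgue2 (A `*` B) = (lebesgue_measure A * lebesgue_measure B)%E.
Proof. exact: product_measure1E. Qed.

Lemma lebesgue2_sigma_finite : sigma_finite setT (@lebesgue2 R).
Proof.
have /sigma_finiteP[F [TF ndF Foo]] := sigma_finiteT (@lebesgue_measure R).
exists (fun n => F n `*` F n).
  rewrite -setXTT TF predeqE => -[x y]; split.
    move=> [/= [n _ Fnx] [k _ Fky]]; exists (maxn n k) => //; split.
    - by move: x Fnx; exact/subsetPset/ndF/leq_maxl.
    - by move: y Fky; exact/subsetPset/ndF/leq_maxr.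
  by move=> [n _ []/= ? ?]; split; exists n.
move=> k; have [? ?] := Foo k; split; first exact: measurableX.
by rewrite lebesgue2X // lte_mul_pinfty// ge0_fin_numE.
Qed.

HB.instance Definition _ := @Measure_isSigmaFinite.Build _ _ _
  (@lebesgue2 R) lebesgue2_sigma_finite.

Definition affine2 (s : R) (t y : R * R) : R * R := (s * y.1 + t.1, s * y.2 + t.2).

Lemma measurable_affine2 s t :
  measurable_fun setT (affine2 s t : mR * mR -> mR * mR).
Proof.
apply/measurable_fun_pairP; split.
  by apply: (measurableT_comp (measurable_affine s t.1)); exact: measurable_fst.
by apply: (measurableT_comp (measurable_affine s t.2)); exact: measurable_snd.
Qed.

Lemma lebesgue2_affine (s : R) (t : R * R) (X : set (mR * mR)) : 0 < s -> measurable X ->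
  lebesgue2 (affine2 s t @^-1` X) = ((s^-1 ^+ 2)%:E * lebesgue2 X)%E.
Proof.
move=> s0 mX; rewrite expr2.
have s0' : 0 < s^-1 by rewrite invr_gt0.
exact: (product_measure_map s0' s0' (measurable_affine s t.1) (measurable_affine s t.2)
  (fun X mX => lebesgue_affine t.1 s0 mX) (fun X mX => lebesgue_affine t.2 s0 mX) mX).
Qed.

Definition lebesgue4 : set ((mR * mR) * (mR * mR)) -> \bar R := (@lebesgue2 R \x @lebesgue2 R)%E.

HB.instance Definition _ := Measure.on lebesgue4.

Definition translate4 (t y : (R * R) * (R * R)) : (R * R) * (R * R) :=
  (affine2 1 t.1 y.1, affine2 1 t.2 y.2).

Lemma lebesgue4_translate t (X : set ((mR * mR) * (mR * mR))) : measurable X ->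
  lebesgue4 (translate4 t @^-1` X) = lebesgue4 X.
Proof.
move=> mX.
have E u : forall Y : set (mR * mR), measurable Y ->
    lebesgue2 (affine2 1 u @^-1` Y) = (1%:E * lebesgue2 Y)%E.
  by move=> Y mY; rewrite lebesgue2_affine // invr1 expr1n.
have := product_measure_map ltr01 ltr01 (measurable_affine2 1 t.1) (measurable_affine2 1 t.2)
  (E t.1) (E t.2) mX.
by rewrite mulr1 mul1e.
Qed.

Lemma lebesgue4X (A B : set (mR * mR)) : measurable A -> measurable B ->
  lebesgue4 (A `*` B) = (lebesgue2 A * lebesgue2 B)%E.
Proof. exact: product_measure1E. Qed.

End AffineMeasure.

(** * Convex bodies and dilates in the plane *)

Section ConvexBodies.
Variable R : realType.
Implicit Types (A : set (R * R)) (c y z : R * R).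
Local Notation mR := (measurableTypeR R).

Definition convex_pair A := forall a x y, 0 <= a <= 1 -> A x -> A y ->
  A (a * x.1 + (1 - a) * y.1, a * x.2 + (1 - a) * y.2).

Lemma convex2_pair A : convex2 A -> convex_pair A.
Proof.
move=> cA a x y /andP[a0 a1] Ax Ay.
by have := cA x y (Itv01 a0 a1); rewrite !inE => /(_ Ax Ay).
Qed.

Definition bounded_pair A := exists2 M, 0 < M & forall y, A y -> `|y.1| <= M /\ `|y.2| <= M.

Lemma bounded_set_pair A : bounded_set (A : set (R^o * R^o)) -> bounded_pair A.
Proof.
move=> [M [_ bM]]; exists (Num.max M 0 + 1).
  by rewrite ltr_wpDl // le_max lexx orbT.
move=> y Ay; have : `|y : R^o * R^o| <= Num.max M 0 + 1.
  by apply: bM => //; rewrite ltr_pwDr // le_max lexx.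
by rewrite /Num.norm /= ge_max => /andP[].
Qed.

(** The image of [z] is a convex combination of a point of [A] close to [z] and a
point close to [c], and so are all points near that image. *)
Lemma convex_contract A c z s : convex_pair A -> interior A c -> closure A z ->
  0 <= s < 1 -> interior A (s * z.1 + (1 - s) * c.1, s * z.2 + (1 - s) * c.2).
Proof.
move=> cA /interior_boxP[e e0 eA] /closure_boxP clA /andP[s0 s1].
have s10 : 0 < 1 - s by rewrite subr_gt0.
have d0 : 0 < (1 - s) * e / 2 by rewrite divr_gt0 // mulr_gt0.
have [z' Az' [z1 z2]] := clA _ d0.
apply/interior_boxP; exists ((1 - s) * e / 2) => // y [/= y1 y2].
pose w := ((y.1 - s * z'.1) / (1 - s), (y.2 - s * z'.2) / (1 - s)).
have sz u : `|u| < (1 - s) * e / 2 -> `|s * u| < (1 - s) * e / 2.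
  move=> ub; rewrite normrM ger0_norm //; apply: le_lt_trans ub.
  by rewrite ler_piMl // ltW.
have aux (u v v' r : R) : `|v' - v| < (1 - s) * e / 2 ->
    `|u - (s * v + (1 - s) * r)| < (1 - s) * e / 2 ->
    `|(u - s * v') / (1 - s) - r| < e.
  move=> h1 h2.
  have -> : (u - s * v') / (1 - s) - r =
      ((u - (s * v + (1 - s) * r)) - s * (v' - v)) / (1 - s).
    by field; rewrite gt_eqF.
  rewrite normrM [X in _ * X]gtr0_norm ?invr_gt0 // ltr_pdivrMr //.
  apply: le_lt_trans (ler_normB _ _) _.
  have := sz _ h1; rewrite [e * _]mulrC; lra.
have Aw : A w by apply: eA; split; apply: aux; eassumption.
have s01 : 0 <= s <= 1 by rewrite s0 ltW.
have := cA s z' w s01 Az' Aw.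
have E (u v : R) : s * v + (1 - s) * ((u - s * v) / (1 - s)) = u.
  by field; rewrite gt_eqF.
by rewrite /w /= !E; case: (y).
Qed.

Lemma lebesgue2_box c e : 0 < e -> lebesgue2 (box c e) = ((e *+ 2) ^+ 2)%:E.
Proof.
move=> e0.
have -> : box c e = `]c.1 - e, c.1 + e[%classic `*` `]c.2 - e, c.2 + e[%classic.
  by apply/seteqP; split => y; rewrite /box /= !in_itv /= !ltr_distl.
have L (x : R) : @lebesgue_measure R `]x - e, x + e[%classic = (e *+ 2)%:E.
  rewrite lebesgue_measure_itv /= lte_fin ltrD2l gtrN //.
  by rewrite -EFinB; congr EFin; ring.
rewrite lebesgue2X; try exact: measurable_itv.
by rewrite (L c.1) (L c.2) -(EFinM (e *+ 2)) expr2.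
Qed.

Lemma le_lebesgue2 (A B : set (mR * mR)) : measurable A -> measurable B ->
  A `<=` B -> (lebesgue2 A <= lebesgue2 B)%E.
Proof. by move=> mA mB; apply: le_measure; rewrite inE. Qed.

Lemma bounded_lebesgue2 A : bounded_pair A -> (lebesgue2 (closure A) < +oo)%E.
Proof.
move=> [M M0 bM].
have M1 : 0 < M + 1 + 1 by rewrite !addr_gt0.
apply: (@le_lt_trans _ _ (lebesgue2 (box (0, 0) (M + 1 + 1)))); last first.
  by rewrite lebesgue2_box // ltry.
apply: le_lebesgue2; [exact: closure_measurable2|exact: measurable_box|].
move=> y /closure_boxP/(_ 1 ltr01)[z /bM[z1 z2] [y1 y2]].
have aux (u v : R) : `|u| <= M -> `|u - v| < 1 -> `|v| < M + 1 + 1.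
  move=> h1 h2; have -> : v = u - (u - v) by ring.
  by apply: le_lt_trans (ler_normB _ _) _; lra.
split; rewrite /= subr0; [exact: aux z1 y1|exact: aux z2 y2].
Qed.

Definition convex_body A := [/\ convex_pair A, bounded_pair A & interior A !=set0].

(** Since [vol] is an outer measure, it may be computed from measurable sets of equal
measure on both sides. *)
Lemma vol_sandwich A (B C : set (mR * mR)) (v : R) : measurable B -> measurable C ->
  B `<=` A -> A `<=` C -> lebesgue2 B = v%:E -> lebesgue2 C = v%:E -> vol A = v.
Proof.
move=> mB mC BA AC vB vC; rewrite /vol.
suff -> : mu_ext (@lebesgue2 R) A = v%:E by [].
apply/eqP; rewrite eq_le; apply/andP; split.
  by rewrite -vC -(measurable_mu_extE (@lebesgue2 R) mC); apply: le_mu_ext.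
by rewrite -vB -(measurable_mu_extE (@lebesgue2 R) mB); apply: le_mu_ext.
Qed.

(** The boundary of a convex body is a null set: every contraction by [s < 1] towards
an interior point maps the closure into the interior, and scales its measure by
[s ^ 2]. *)
Lemma convex_body_vol A : convex_body A -> [/\ lebesgue2 (interior A) = (vol A)%:E,
  lebesgue2 (closure A) = (vol A)%:E & 0 < vol A].
Proof.
move=> [cA bA [c ic]].
have mi := @interior_measurable2 R A; have mc := @closure_measurable2 R A.
have ic_le : (lebesgue2 (interior A) <= lebesgue2 (closure A))%E.
  by apply: le_lebesgue2 => // y iy; apply: subset_closure; apply: interior_subset.
have cfin := bounded_lebesgue2 bA.
have ifin := le_lt_trans ic_le cfin.
have c_ge0 : (0 <= lebesgue2 (closure A))%E by exact: measure_ge0.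
have i_ge0 : (0 <= lebesgue2 (interior A))%E by exact: measure_ge0.
have [x xE] : exists x, lebesgue2 (closure A) = x%:E.
  by exists (fine (lebesgue2 (closure A))); rewrite fineK // ge0_fin_numE.
have [y yE] : exists y : R, lebesgue2 (interior A) = y%:E.
  by exists (fine (lebesgue2 (interior A))); rewrite fineK // ge0_fin_numE.
rewrite xE yE in ic_le cfin ifin c_ge0 i_ge0 *.
rewrite !lee_fin in ic_le c_ge0 i_ge0.
have y0 : 0 < y.
  have /interior_boxP[e e0 eA] := ic.
  have : (lebesgue2 (box c e) <= lebesgue2 (interior A))%E.
    apply: le_lebesgue2 => //; first exact: measurable_box.
    have ob : open (box c e).
      apply: open_boxP => z [z1 z2].
      exists (Num.min (e - `|z.1 - c.1|) (e - `|z.2 - c.2|)).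
        by rewrite lt_min !subr_gt0 z1 z2.
      have aux (u v w : R) : `|u - v| < e - `|v - w| -> `|u - w| < e.
        move=> h; have -> : u - w = (u - v) + (v - w) by ring.
        by apply: le_lt_trans (ler_normD _ _) _; lra.
      by move=> w [w1 w2]; move: w1 w2; rewrite !lt_min => /andP[w1 _] /andP[_ w2];
        split; [exact: aux w1|exact: aux w2].
    by rewrite -(open_subsetE A ob).
  by rewrite lebesgue2_box // yE lee_fin; apply: lt_le_trans; rewrite exprn_gt0 // mulrn_wgt0.
have shrink (s : R) : 0 < s < 1 -> s ^+ 2 * x <= y.
  move=> /andP[s0 s1].
  pose t := ((1 - s) * c.1, (1 - s) * c.2).
  have : (lebesgue2 (closure A) <= lebesgue2 (affine2 s t @^-1` interior A))%E.
    apply: le_lebesgue2 => //.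
      by rewrite -[X in measurable X]setTI; apply: measurable_affine2.
    by move=> z cz; apply: convex_contract => //; rewrite ltW.
  rewrite lebesgue2_affine // xE yE -(EFinM _ y) lee_fin exprVn mulrC ler_pdivlMr ?exprn_gt0 //.
  by rewrite mulrC.
have xy : x = y.
  apply/eqP; rewrite eq_le ic_le andbT leNgt; apply/negP => yx.
  have x0 : 0 < x by apply: lt_trans yx.
  (* With this factor [s], the inequality [s ^ 2 * x <= y] says
  [(x + y) ^ 2 <= 4 * x * y], which fails when [x] and [y] differ. *)
  have sE : 0 < (x + y) / (2 * x) < 1.
    rewrite divr_gt0 ?mulr_gt0 ?addr_gt0 //= ltr_pdivrMr ?mulr_gt0 // mul1r.
    lra.
  have := shrink _ sE.
  have -> : ((x + y) / (2 * x)) ^+ 2 * x = (x + y) ^+ 2 / (4 * x).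
    by field; rewrite gt_eqF.
  rewrite ler_pdivrMr ?mulr_gt0 //.
  have : 0 < (x - y) ^+ 2 by rewrite exprn_gt0 // subr_gt0.
  nra.
have -> : vol A = y.
  apply: (vol_sandwich mi mc) => //; [exact: interior_subset|exact: subset_closure|].
  by rewrite xE xy.
by rewrite xy.
Qed.

End ConvexBodies.

Section Dilate.
Variable R : realType.
Local Notation mR := (measurableTypeR R).
Implicit Types (D A : set (R * R)).

(** With empty interior, the null boundary would be the whole closure. *)
Lemma averaging_interior D : averaging_set D -> interior D !=set0.
Proof.
move=> [[bD nD] vD]; apply: contrapT => /nonemptyPn iD.
move: vD; rewrite /vol ltNge => /negP; apply.
have nc : lebesgue2 (closure D) = 0%E by move: nD; rewrite iD setD0.
suff -> : mu_ext (@lebesgue2 R) D = 0%E by [].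
apply/eqP; rewrite eq_le mu_ext_ge0 // andbT -nc.
rewrite -(measurable_mu_extE (@lebesgue2 R) (@closure_measurable2 R D)).
by apply: le_mu_ext; apply: subset_closure.
Qed.

(** For convex [D], the union of the [t D] with [t] in the unit interval is the convex
hull of [D] and the origin. *)
Lemma dilate_body D : averaging_set D -> convex2 D -> convex_body (dilate 1 D).
Proof.
move=> aD /convex2_pair cD; have [c ic] := averaging_interior aD.
have [[/bounded_set_pair[M M0 bM] _] _] := aD.
split.
- move=> a _ _ /andP[a0 a1] [t [x [t0 t1 Dx ->]]] [u [y [u0 u1 Dy ->]]].
  rewrite !scale_pair /=.
  pose s := a * t + (1 - a) * u.
  have b0 : 0 <= 1 - a by rewrite subr_ge0.
  have s1 : s <= 1.
    have := ler_wpM2l a0 t1; have := ler_wpM2l b0 u1; rewrite /s; lra.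
  have at0 : 0 <= a * t by rewrite mulr_ge0.
  have bu0 : 0 <= (1 - a) * u by rewrite mulr_ge0.
  have s0 : 0 <= s by rewrite addr_ge0.
  have [s00|s00] := eqVneq s 0.
    exists 0, x; split => //; rewrite scale_pair !mul0r.
    have : a * t = 0 /\ (1 - a) * u = 0 by move: s00; rewrite /s; lra.
    by case=> h1 h2; rewrite !mulrA h1 h2 !mul0r addr0.
  have sp : 0 < s by rewrite lt_neqAle eq_sym s00.
  pose b := a * t / s.
  have b01 : 0 <= b <= 1.
    by rewrite divr_ge0 //= ler_pdivrMr // mul1r lerDl.
  exists s, (b * x.1 + (1 - b) * y.1, b * x.2 + (1 - b) * y.2).
  split => //; first exact: cD.
  have bs : s * b = a * t by rewrite /b mulrC mulfVK.
  have E (v w : R) : a * (t * v) + (1 - a) * (u * w) = s * (b * v + (1 - b) * w).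
    have -> : s * (b * v + (1 - b) * w) = (s * b) * v + (s - s * b) * w by ring.
    by rewrite bs /s; ring.
  by rewrite scale_pair /= !E.
- exists M => // _ [t [x [t0 t1 /bM[x1 x2] ->]]]; rewrite scale_pair /=.
  rewrite !normrM ger0_norm //.
  by split; [apply: le_trans x1|apply: le_trans x2]; rewrite ler_piMl.
exists c; move: ic => /interior_boxP[e e0 eD]; apply/interior_boxP; exists e => // y /eD Dy.
by exists 1, y; split => //; rewrite scale_pair !mul1r; case: (y).
Qed.

Lemma dilate_scale D (T : R) (y : R * R) : 0 < T ->
  dilate T D y <-> dilate 1 D (T^-1 * y.1, T^-1 * y.2).
Proof.
move=> T0; split.
  move=> [t [x [t0 tT Dx ->]]]; rewrite scale_pair /=.
  exists (T^-1 * t), x; split => //.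
  - by rewrite mulr_ge0 // invr_ge0 ltW.
  - by rewrite mulrC ler_pdivrMr // mul1r.
  by rewrite scale_pair !mulrA.
move=> [t [x [t0 t1 Dx]]]; rewrite scale_pair => -[e1 e2].
exists (T * t), x; split => //.
- by rewrite mulr_ge0 // ltW.
- by rewrite ler_piMr // ltW.
rewrite scale_pair -!mulrA -e1 -e2 !mulVKf ?gt_eqF //; by case: (y).
Qed.

Lemma vol_dilate D (T : R) : averaging_set D -> convex2 D -> 0 < T ->
  vol (dilate T D) = T ^+ 2 * vol (dilate 1 D).
Proof.
move=> aD cD T0; have bD := dilate_body aD cD.
have [vi vc _] := convex_body_vol bD.
have T0' : 0 < T^-1 by rewrite invr_gt0.
have E y : affine2 T^-1 (0, 0) y = (T^-1 * y.1, T^-1 * y.2) by rewrite /affine2 !addr0.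
apply: (@vol_sandwich _ _ (affine2 T^-1 (0, 0) @^-1` interior (dilate 1 D))
  (affine2 T^-1 (0, 0) @^-1` closure (dilate 1 D))).
- by rewrite -[X in measurable X]setTI; apply: measurable_affine2 => //; exact: interior_measurable2.
- by rewrite -[X in measurable X]setTI; apply: measurable_affine2 => //; exact: closure_measurable2.
- by move=> y /= iy; apply/dilate_scale => //; rewrite -E; apply: interior_subset.
- by move=> y /dilate_scale dy; rewrite /= E; apply: subset_closure; apply: dy.
- rewrite lebesgue2_affine //; last exact: interior_measurable2.
  by rewrite vi invrK EFinM.
- rewrite lebesgue2_affine //; last exact: closure_measurable2.
  by rewrite vc invrK EFinM.
Qed.

End Dilate.

(** * Counting lattice points by cells *)

Section LatticeCells.
Variables (R : realType) (w1 w2 : R).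
Hypothesis w21 : w2 < w1.
Local Notation mR := (measurableTypeR R).
Local Notation index := ((int * int) * (int * int))%type.
Implicit Types (k : index) (y : (R * R) * (R * R)).

(** Two copies of the planar lattice spanned by [(1, 1)] and [(w1, w2)], with the
coordinates regrouped into a physical and an internal pair. *)
Definition lattice_point k : (R * R) * (R * R) :=
  ((k.1.1%:~R + k.1.2%:~R * w1, k.2.1%:~R + k.2.2%:~R * w1),
   (k.1.1%:~R + k.1.2%:~R * w2, k.2.1%:~R + k.2.2%:~R * w2)).

(** [coord1] and [coord2] are the coordinates of [(u, v)] in the basis [(1, 1)],
[(w1, w2)]; their integral parts index the cells. *)
Definition coord2 (u v : R) : R := (u - v) / (w1 - w2).
Definition coord1 (u v : R) : R := u - coord2 u v * w1.

Definition cell_index y : index :=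
  ((Num.floor (coord1 y.1.1 y.2.1), Num.floor (coord2 y.1.1 y.2.1)),
   (Num.floor (coord1 y.1.2 y.2.2), Num.floor (coord2 y.1.2 y.2.2))).

Definition cell k : set ((mR * mR) * (mR * mR)) := [set y | cell_index y = k].

Let dw0 : w1 - w2 != 0.
Proof. by rewrite subr_eq0 gt_eqF. Qed.

Lemma coordK u v : u = coord1 u v + coord2 u v * w1 /\ v = coord1 u v + coord2 u v * w2.
Proof. by rewrite /coord1 /coord2; split; field. Qed.

(** A bound for the coordinates of the points of a fundamental cell. *)
Definition radius : R := 1 + `|w1| + `|w2|.

Lemma radius_gt0 : 0 < radius.
Proof. by rewrite /radius -addrA ltr_pwDl // addr_ge0. Qed.

Lemma floor_near (u v : R) (m n : int) :
  Num.floor (coord1 u v) = m -> Num.floor (coord2 u v) = n ->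
  `|u - (m%:~R + n%:~R * w1)| <= radius /\ `|v - (m%:~R + n%:~R * w2)| <= radius.
Proof.
move=> fm fn; have [uE vE] := coordK u v.
have /andP[m1 m2] := floor_itv (coord1 u v).
have /andP[n1 n2] := floor_itv (coord2 u v).
rewrite fm intrD in m1 m2; rewrite fn intrD in n1 n2.
move: (coord1 u v) (coord2 u v) uE vE m1 m2 n1 n2 {fm fn} => a b -> -> m1 m2 n1 n2.
have aux (w : R) : `|w| <= `|w1| + `|w2| ->
    `|a + b * w - (m%:~R + n%:~R * w)| <= radius.
  move=> hw.
  have -> : a + b * w - (m%:~R + n%:~R * w) = (a - m%:~R) + (b - n%:~R) * w by ring.
  have h1 : `|a - m%:~R| <= 1 by rewrite ler_norml; apply/andP; split; lra.
  have h2 : `|b - n%:~R| <= 1 by rewrite ler_norml; apply/andP; split; lra.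
  apply: le_trans (ler_normD _ _) _; rewrite normrM /radius -(addrA 1); apply: lerD => //.
  by apply: le_trans hw; rewrite ler_piMl.
by split; apply: aux; rewrite ?lerDl ?lerDr.
Qed.

Lemma cell_near k y : cell k y ->
  (`|y.1.1 - (lattice_point k).1.1| <= radius /\
   `|y.1.2 - (lattice_point k).1.2| <= radius) /\
  (`|y.2.1 - (lattice_point k).2.1| <= radius /\
   `|y.2.2 - (lattice_point k).2.2| <= radius).
Proof.
move=> yk; have E := esym yk; rewrite E /lattice_point /=.
have [h1 h2] := floor_near (erefl (Num.floor (coord1 y.1.1 y.2.1)))
  (erefl (Num.floor (coord2 y.1.1 y.2.1))).
have [h3 h4] := floor_near (erefl (Num.floor (coord1 y.1.2 y.2.2)))
  (erefl (Num.floor (coord2 y.1.2 y.2.2))).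
by [].
Qed.

Lemma measurable_cell k : measurable (cell k).
Proof.
have m11 : measurable_fun setT ((fun y => y.1.1) : (mR * mR) * (mR * mR) -> mR).
  by apply: (measurableT_comp measurable_fst); exact: measurable_fst.
have m12 : measurable_fun setT ((fun y => y.1.2) : (mR * mR) * (mR * mR) -> mR).
  by apply: (measurableT_comp measurable_snd); exact: measurable_fst.
have m21 : measurable_fun setT ((fun y => y.2.1) : (mR * mR) * (mR * mR) -> mR).
  by apply: (measurableT_comp measurable_fst); exact: measurable_snd.
have m22 : measurable_fun setT ((fun y => y.2.2) : (mR * mR) * (mR * mR) -> mR).
  by apply: (measurableT_comp measurable_snd); exact: measurable_snd.
have mc2 (u v : (mR * mR) * (mR * mR) -> mR) : measurable_fun setT u ->
    measurable_fun setT v -> measurable_fun setT ((fun y => coord2 (u y) (v y)) : _ -> mR).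
  by move=> mu mv; apply: measurable_funM => //; apply: measurable_funB.
have mc1 (u v : (mR * mR) * (mR * mR) -> mR) : measurable_fun setT u ->
    measurable_fun setT v -> measurable_fun setT ((fun y => coord1 (u y) (v y)) : _ -> mR).
  move=> mu mv; apply: measurable_funB => //; apply: measurable_funM => //.
  exact: mc2.
have mfl (f : (mR * mR) * (mR * mR) -> mR) (n : int) : measurable_fun setT f ->
    measurable [set y | Num.floor (f y) = n].
  move=> mf; have -> : [set y | Num.floor (f y) = n] = f @^-1` [set` `[n%:~R, (n + 1)%:~R[%R].
    apply/seteqP; split => y /=; rewrite in_itv /=.
      by move=> <-; apply: floor_itv.
    exact: floor_def.
  by rewrite -[X in measurable X]setTI; apply: mf => //; exact: measurable_itv.
have -> : cell k = ([set y | Num.floor (coord1 y.1.1 y.2.1) = k.1.1] `&`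
    [set y | Num.floor (coord2 y.1.1 y.2.1) = k.1.2]) `&`
    ([set y | Num.floor (coord1 y.1.2 y.2.2) = k.2.1] `&`
    [set y | Num.floor (coord2 y.1.2 y.2.2) = k.2.2]).
  rewrite /cell /cell_index; apply/seteqP; split => y /=; first by move=> <-.
  by case: (k) => -[a b] [c d] /= [[-> ->] [-> ->]].
by apply: measurableI; apply: measurableI; apply: mfl; [apply: mc1|apply: mc2|apply: mc1|apply: mc2].
Qed.

Lemma cell_translate k : cell k = translate4
  ((- (lattice_point k).1.1, - (lattice_point k).1.2),
   (- (lattice_point k).2.1, - (lattice_point k).2.2)) @^-1` cell ((0, 0), (0, 0)).
Proof.
have aux (u v : R) (m n : int) :
    coord1 (1 * u + - (m%:~R + n%:~R * w1)) (1 * v + - (m%:~R + n%:~R * w2)) =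
      coord1 u v + (- m)%:~R /\
    coord2 (1 * u + - (m%:~R + n%:~R * w1)) (1 * v + - (m%:~R + n%:~R * w2)) =
      coord2 u v + (- n)%:~R.
  by rewrite /coord1 /coord2 !mulrNz; split; field.
have fl (x : R) (m : int) : Num.floor (x + (- m)%:~R) = Num.floor x - m.
  by rewrite floorDrz ?intr_int // intrKfloor.
case: k => -[m n] [m' n']; apply/seteqP; split => -[[a b] [c d]];
  rewrite /cell /cell_index /=.
  move=> [e1 e2 e3 e4].
  rewrite !(aux a c m n).1 !(aux a c m n).2 !(aux b d m' n').1 !(aux b d m' n').2 !fl.
  by rewrite e1 e2 e3 e4 !subrr.
rewrite !(aux a c m n).1 !(aux a c m n).2 !(aux b d m' n').1 !(aux b d m' n').2 !fl.
move=> [/eqP + /eqP + /eqP + /eqP]; rewrite !subr_eq0.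
by move=> /eqP -> /eqP -> /eqP -> /eqP ->.
Qed.

Definition covolume : R := fine (lebesgue4 (cell ((0, 0), (0, 0)))).

Lemma lebesgue4_cell k : lebesgue4 (cell k) = covolume%:E.
Proof.
rewrite cell_translate lebesgue4_translate; last exact: measurable_cell.
rewrite /covolume fineK // ge0_fin_numE; last exact: measure_ge0.
have r0 : 0 < radius + 1 by rewrite addr_gt0 // radius_gt0.
apply: (@le_lt_trans _ _ (lebesgue4 (box (0, 0) (radius + 1) `*` box (0, 0) (radius + 1)))).
  apply: le_measure; rewrite ?inE; first exact: measurable_cell.
    by apply: measurableX; exact: measurable_box.
  move=> y /cell_near; rewrite /lattice_point /= !mul0r !addr0 => -[[a b] [c d]].
  have r1 : radius < radius + 1 by rewrite ltrDl.
  by split; split; rewrite /= subr0; apply: le_lt_trans r1; rewrite -[X in `|X|]subr0.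
rewrite lebesgue4X; try exact: measurable_box.
by rewrite lebesgue2_box // -EFinM ltry.
Qed.

Lemma lebesgue4_cells (F : {fset index}) :
  lebesgue4 (\bigcup_(k in [set` F]) cell k) = (#|` F|%:R * covolume)%:E.
Proof.
rewrite bigcup_fset measure_fbigsetU /=; last 2 first.
- by move=> k _; exact: measurable_cell.
- by move=> k l _ _ [y [<- <-]].
rewrite (eq_bigr (fun=> covolume%:E)) => [|k _]; last exact: lebesgue4_cell.
by rewrite sumEFin big_const_seq count_predT iter_addr addr0 mulr_natl.
Qed.

(** Countably many translates of a null cell could not cover the space. *)
Lemma covolume_gt0 : 0 < covolume.
Proof.
rewrite lt_neqAle eq_sym fine_ge0 ?andbT; last exact: measure_ge0.
apply/eqP => c0.
pose F (n : nat) := if choice.unpickle n is Some k then cell k else set0.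
have mF n : measurable (F n).
  by rewrite /F; case: choice.unpickle => [k|]; [exact: measurable_cell|exact: measurable0].
have zF n : lebesgue4 (F n) = 0%E.
  by rewrite /F; case: choice.unpickle => [k|]; [rewrite lebesgue4_cell c0|exact: measure0].
have FE k : F (choice.pickle k) = cell k by rewrite /F choice.pickleK.
clearbody F; pose B := (box (0, 0) 1 `*` box (0, 0) 1 : set ((mR * mR) * (mR * mR))).
have mB : measurable B by apply: measurableX; exact: measurable_box.
have : (lebesgue4 B <= \sum_(0 <= n <oo) lebesgue4 (F n))%E.
  apply: measure_sigma_subadditive => // y _.
  by exists (choice.pickle (cell_index y)); [exact: I|rewrite FE].
rewrite eseries0; last by move=> n _ _; exact: zF.
rewrite leNgt lebesgue4X; try exact: measurable_box.
by rewrite lebesgue2_box // -EFinM lte_fin mulr_gt0 // exprn_gt0.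
Qed.

(** Enlarging or shrinking the dilation factor by [C] absorbs displacements by at most
[radius]: such a displacement, divided by [C], keeps the centre [c] in the body, and
the body is convex.  The translation by [C c] makes this work for a body that does
not contain the origin in its interior. *)
Section Padding.
Variables (A : set (R * R)) (c : R * R) (e C a : R).
Hypotheses (cA : convex_pair A) (eA : box c e `<=` A) (eC : radius < e * C).
Hypotheses (C0 : 0 < C) (a0 : 0 < a).

Definition scaled (a : R) (A : set (R * R)) (u : R * R) : Prop := A (a^-1 * u.1, a^-1 * u.2).

Let pad (p : R) : `|p| <= radius -> `|p / C| < e.
Proof.
by move=> pr; rewrite normrM normfV (gtr0_norm C0) ltr_pdivrMr //; apply: le_lt_trans eC.
Qed.

Lemma scaled_pad (u y : R * R) : `|y.1 - u.1| <= radius -> `|y.2 - u.2| <= radius ->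
  scaled a A u ->
  A (affine2 (a + C)^-1 ((a + C)^-1 * C * c.1, (a + C)^-1 * C * c.2) y).
Proof.
move=> y1 y2 Au.
have aC0 : 0 < a + C by rewrite addr_gt0.
have Aw : A (c.1 + (y.1 - u.1) / C, c.2 + (y.2 - u.2) / C).
  by apply: eA; split; rewrite /= addrC addKr; apply: pad.
have s01 : 0 <= a / (a + C) <= 1.
  by rewrite ler_pdivrMr // mul1r lerDl (ltW C0) andbT divr_ge0 // ltW.
have := cA s01 Au Aw; rewrite /affine2 /=.
by congr (A (_, _)); field; rewrite !gt_eqF.
Qed.

Lemma scaled_unpad (u y : R * R) : `|y.1 - u.1| <= radius -> `|y.2 - u.2| <= radius ->
  C < a ->
  A (affine2 (a - C)^-1 (- ((a - C)^-1 * C * c.1), - ((a - C)^-1 * C * c.2)) y) ->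
  scaled a A u.
Proof.
move=> y1 y2 Ca Ay.
have aC0 : 0 < a - C by rewrite subr_gt0.
have Aw : A (c.1 + (u.1 - y.1) / C, c.2 + (u.2 - y.2) / C).
  by apply: eA; split; rewrite /= addrC addKr; apply: pad; rewrite distrC.
have s01 : 0 <= (a - C) / a <= 1.
  by rewrite ler_pdivrMr // mul1r gerBl (ltW C0) andbT divr_ge0 // ltW.
have := cA s01 Ay Aw; rewrite /affine2 /scaled /=.
by congr (A (_, _)); field; rewrite !gt_eqF.
Qed.

End Padding.

(** The cells of the lattice points of [a A * b B] lie in a translate of
[(a + C) A * (b + C) B] and cover a translate of [(a - C) A * (b - C) B]; the measures
of these sets are compared. *)
Lemma lattice_count (A B : set (R * R)) : convex_body A -> convex_body B ->
  exists2 C, 0 < C & forall a b, 0 < a -> 0 < b ->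
    let Z := [set k | scaled a A (lattice_point k).1 /\ scaled b B (lattice_point k).2] in
    [/\ finite_set Z,
        #|` fset_set Z|%:R * covolume <= ((a + C) * (b + C)) ^+ 2 * (vol A * vol B) &
        C < a -> C < b ->
        ((a - C) * (b - C)) ^+ 2 * (vol A * vol B) <= #|` fset_set Z|%:R * covolume].
Proof.
move=> bA bB; have [cA _ [c /interior_boxP[e e0 eA]]] := bA.
have [cB _ [d /interior_boxP[f f0 fB]]] := bB.
have [vAi vAc vA0] := convex_body_vol bA; have [vBi vBc vB0] := convex_body_vol bB.
have r0 := radius_gt0.
pose C := (radius + 1) / Num.min e f.
have m0 : 0 < Num.min e f by rewrite lt_min e0 f0.
have C0 : 0 < C by rewrite divr_gt0 // addr_gt0.
have eC : radius < e * C.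
  apply: (@lt_le_trans _ _ (Num.min e f * C)).
    by rewrite /C mulrC mulfVK ?gt_eqF // ltrDl.
  by rewrite ler_wpM2r ?(ltW C0) // ge_min lexx.
have fC : radius < f * C.
  apply: (@lt_le_trans _ _ (Num.min e f * C)).
    by rewrite /C mulrC mulfVK ?gt_eqF // ltrDl.
  by rewrite ler_wpM2r ?(ltW C0) // ge_min lexx orbT.
exists C => // a b a0 b0 Z.
have aC : 0 < (a + C)^-1 by rewrite invr_gt0 addr_gt0.
have bC : 0 < (b + C)^-1 by rewrite invr_gt0 addr_gt0.
pose U := affine2 (a + C)^-1 ((a + C)^-1 * C * c.1, (a + C)^-1 * C * c.2) @^-1` closure A.
pose V := affine2 (b + C)^-1 ((b + C)^-1 * C * d.1, (b + C)^-1 * C * d.2) @^-1` closure B.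
have mpre s t (X : set (mR * mR)) : measurable X -> measurable (affine2 s t @^-1` X : set (mR * mR)).
  by move=> mX; rewrite -[X in measurable X]setTI; apply: measurable_affine2.
have mU : measurable (U : set (mR * mR)) by apply: mpre; exact: closure_measurable2.
have mV : measurable (V : set (mR * mR)) by apply: mpre; exact: closure_measurable2.
have UV : lebesgue4 (U `*` V) = (((a + C) * (b + C)) ^+ 2 * (vol A * vol B))%:E.
  rewrite lebesgue4X // /U /V !lebesgue2_affine //; try exact: closure_measurable2.
  rewrite vAc vBc -!EFinM !invrK exprMn; congr EFin; ring.
have ub (F : {fset index}) : [set` F] `<=` Z ->
    #|` F|%:R * covolume <= ((a + C) * (b + C)) ^+ 2 * (vol A * vol B).
  move=> FZ; rewrite -lee_fin -UV -lebesgue4_cells.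
  apply: le_measure; rewrite ?inE.
  - by apply: fin_bigcup_measurable => // k _; exact: measurable_cell.
  - exact: measurableX.
  move=> y [k /FZ[kA kB] /cell_near[[y1 y2] [y3 y4]]]; split; apply: subset_closure.
    exact: (scaled_pad cA eA eC C0 a0 y1 y2 kA).
  exact: (scaled_pad cB fB fC C0 b0 y3 y4 kB).
have finZ : finite_set Z.
  apply: contrapT => infZ.
  pose n := (Num.truncn (((a + C) * (b + C)) ^+ 2 * (vol A * vol B) / covolume)).+1.
  have [F FZ nF] := infinite_set_fset n infZ.
  have := ub F FZ; rewrite leNgt -ltr_pdivrMr ?covolume_gt0 // => /negP; apply.
  by apply: (lt_le_trans (truncnS_gt _)); rewrite ler_nat.
have FZ : [set` fset_set Z] = Z by rewrite fset_setK.
split=> //; first by apply: ub; rewrite FZ.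
move=> Ca Cb.
have aC' : 0 < (a - C)^-1 by rewrite invr_gt0 subr_gt0.
have bC' : 0 < (b - C)^-1 by rewrite invr_gt0 subr_gt0.
pose U' := affine2 (a - C)^-1 (- ((a - C)^-1 * C * c.1), - ((a - C)^-1 * C * c.2)) @^-1` interior A.
pose V' := affine2 (b - C)^-1 (- ((b - C)^-1 * C * d.1), - ((b - C)^-1 * C * d.2)) @^-1` interior B.
have mU' : measurable (U' : set (mR * mR)) by apply: mpre; exact: interior_measurable2.
have mV' : measurable (V' : set (mR * mR)) by apply: mpre; exact: interior_measurable2.
have UV' : lebesgue4 (U' `*` V') = (((a - C) * (b - C)) ^+ 2 * (vol A * vol B))%:E.
  rewrite lebesgue4X // /U' /V' !lebesgue2_affine //; try exact: interior_measurable2.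
  rewrite vAi vBi -!EFinM !invrK exprMn; congr EFin; ring.
rewrite -lee_fin -UV' -lebesgue4_cells FZ.
apply: le_measure; rewrite ?inE.
- exact: measurableX.
- by apply: fin_bigcup_measurable => // k _; exact: measurable_cell.
move=> y [/interior_subset yU /interior_subset yV].
exists (cell_index y) => //; have [[y1 y2] [y3 y4]] := @cell_near _ y erefl.
split; first exact: (scaled_unpad cA eA eC C0 a0 y1 y2 Ca yU).
exact: (scaled_unpad cB fB fC C0 b0 y3 y4 Cb yV).
Qed.

End LatticeCells.

(** * Window counts and the sieve *)

Section Counting.
Variable R : realType.

Definition cnt (T : choiceType) (X : set T) : R := #|` fset_set X|%:R.

Lemma cnt_ge0 (T : choiceType) (X : set T) : 0 <= cnt X.
Proof. exact: ler0n. Qed.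

Lemma cnt_image (T U : choiceType) (f : T -> U) (X : set T) :
  finite_set X -> injective f -> cnt (f @` X) = cnt X.
Proof. by move=> fX fI; rewrite /cnt fset_set_image // card_imfset. Qed.

Lemma cnt_setD (T : choiceType) (X Y : set T) : finite_set X -> Y `<=` X ->
  cnt (X `\` Y) = cnt X - cnt Y.
Proof.
move=> fX YX; have fY := sub_finite_set YX fX.
have YXs : (fset_set Y `<=` fset_set X)%fset by rewrite -fset_set_sub.
rewrite /cnt fset_setD // cardfsDS // natrB //.
exact: fsubset_leq_card.
Qed.

Lemma cnt_set1 (T : choiceType) (x : T) : cnt [set x] = 1.
Proof. by rewrite /cnt fset_set1 cardfs1. Qed.

Lemma cnt_set0 (T : choiceType) : cnt (@set0 T) = 0.
Proof. by rewrite /cnt fset_set0 cardfs0. Qed.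

(** When [a] and [b] are of the order of [r], [(a + C) * (b + C)] and
[(a - C) * (b - C)] differ from [r ^ 2] by at most [D * r], so the bounds of the cell
count are within [O(r ^ 3)] of each other.  The lower bound is vacuous for [r <= D].
The counts [n] and [nf] stand for the lattice points without and with the origin. *)
Lemma cell_bounds_asymp (r r0 C L a b V kappa n nf D : R) :
  0 < r0 -> r0 <= r -> 0 < C -> 1 <= L -> 0 < a -> 0 < b -> a * b = r ^+ 2 ->
  a <= L * r -> b <= L * r -> r <= L * a -> r <= L * b ->
  0 < V -> 0 < kappa -> nf - 1 <= n -> n <= nf -> 0 <= nf ->
  nf * kappa <= ((a + C) * (b + C)) ^+ 2 * V ->
  (C < a -> C < b -> ((a - C) * (b - C)) ^+ 2 * V <= nf * kappa) ->
  D = 2 * C * L + C ^+ 2 / r0 ->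
  `|n - V / kappa * (r ^+ 2) ^+ 2| <= (V * (2 * D + D ^+ 2 / r0) / kappa + r0^-1 ^+ 3) * r ^+ 3.
Proof.
move=> r00 rr0 C0 L1 a0 b0 ab aL bL ra rb V0 k0 n1 n2 nf0 up lo DE.
have rp : 0 < r by apply: lt_le_trans rr0.
have L0 : 0 < L by apply: lt_le_trans L1.
have D0 : 0 < D by rewrite DE addr_gt0 ?divr_gt0 ?mulr_gt0 ?exprn_gt0.
have rr01 : 1 <= r / r0 by rewrite ler_pdivlMr // mul1r.
have CD : C * (a + b) + C ^+ 2 <= D * r.
  have h1 : C * (a + b) <= C * (L * r + L * r) by rewrite ler_pM2l // lerD.
  have h2 : C ^+ 2 <= C ^+ 2 * (r / r0) by rewrite ler_peMr // exprn_ge0 // ltW.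
  have -> : D * r = C * (L * r + L * r) + C ^+ 2 * (r / r0).
    by rewrite DE; field; rewrite gt_eqF.
  exact: lerD.
have CD2 : C * (a + b) <= D * r by apply: le_trans CD; rewrite lerDl exprn_ge0 // ltW.
have sq_up : ((a + C) * (b + C)) ^+ 2 <= (r ^+ 2 + D * r) ^+ 2.
  rewrite ler_pXn2r ?nnegrE //.
  - have -> : (a + C) * (b + C) = r ^+ 2 + (C * (a + b) + C ^+ 2) by rewrite -ab; ring.
    by rewrite lerD2l.
  - by rewrite mulr_ge0 // addr_ge0 // ltW.
  - by rewrite addr_ge0 ?exprn_ge0 ?mulr_ge0 // ltW.
have cube : (r ^+ 2 + D * r) ^+ 2 <= (r ^+ 2) ^+ 2 + (2 * D + D ^+ 2 / r0) * r ^+ 3.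
  have -> : (r ^+ 2 + D * r) ^+ 2 = (r ^+ 2) ^+ 2 + 2 * D * r ^+ 3 + D ^+ 2 * r ^+ 2 by ring.
  have -> : (r ^+ 2) ^+ 2 + (2 * D + D ^+ 2 / r0) * r ^+ 3 =
      (r ^+ 2) ^+ 2 + 2 * D * r ^+ 3 + D ^+ 2 * r ^+ 2 * (r / r0) by ring.
  by rewrite lerD2l ler_peMr // mulr_ge0 // exprn_ge0 // ltW.
have low : V * ((r ^+ 2) ^+ 2 - 2 * D * r ^+ 3) <= nf * kappa.
  have small : r <= D -> V * ((r ^+ 2) ^+ 2 - 2 * D * r ^+ 3) <= nf * kappa.
    move=> rD; apply: (@le_trans _ _ 0); last by rewrite mulr_ge0 // ltW.
    rewrite pmulr_rle0 // subr_le0.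
    have -> : (r ^+ 2) ^+ 2 = r * r ^+ 3 by ring.
    rewrite ler_pM2r ?exprn_gt0 //; lra.
  have [rD|rD] := leP r D; first exact: small.
  have CL : C * L <= D.
    have : 0 <= C ^+ 2 / r0 by rewrite divr_ge0 ?exprn_ge0 ?ltW.
    have : 0 <= C * L by rewrite mulr_ge0 // ltW.
    by rewrite DE; lra.
  have [aC|aC] := leP a C.
    apply: small; apply: le_trans ra _; apply: le_trans CL.
    by rewrite mulrC ler_pM2r.
  have [bC|bC] := leP b C.
    apply: small; apply: le_trans rb _; apply: le_trans CL.
    by rewrite mulrC ler_pM2r.
  apply: le_trans (lo aC bC); rewrite mulrC ler_pM2r //.
  apply: (@le_trans _ _ ((r ^+ 2 - D * r) ^+ 2)).
    have -> : (r ^+ 2 - D * r) ^+ 2 = (r ^+ 2) ^+ 2 - 2 * D * r ^+ 3 + D ^+ 2 * r ^+ 2 by ring.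
    by rewrite lerDl mulr_ge0 // exprn_ge0 // ltW.
  rewrite ler_pXn2r ?nnegrE //.
  - have -> : (a - C) * (b - C) = r ^+ 2 - C * (a + b) + C ^+ 2 by rewrite -ab; ring.
    have : 0 < C ^+ 2 by rewrite exprn_gt0.
    by move: CD2; lra.
  - by rewrite expr2 -mulrBl mulr_ge0 ?subr_ge0 // ltW.
  - by rewrite mulr_ge0 // subr_ge0 ltW.
have r3 : 1 <= r0^-1 ^+ 3 * r ^+ 3.
  by rewrite -exprMn mulrC exprn_ege1.
set E := 2 * D + D ^+ 2 / r0.
have D2E : 2 * D <= E by rewrite lerDl divr_ge0 ?exprn_ge0 // ltW.
have r30 : 0 < r ^+ 3 by rewrite exprn_gt0.
have -> : (V * E / kappa + r0^-1 ^+ 3) * r ^+ 3 =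
    (V * E * r ^+ 3) / kappa + r0^-1 ^+ 3 * r ^+ 3 by ring.
have -> : V / kappa * (r ^+ 2) ^+ 2 = (V * (r ^+ 2) ^+ 2) / kappa by ring.
have up' : nf <= (V * (r ^+ 2) ^+ 2) / kappa + (V * E * r ^+ 3) / kappa.
  rewrite -mulrDl ler_pdivlMr //; apply: le_trans up _.
  rewrite -[V * E * _]mulrA -mulrDr mulrC ler_pM2l //.
  exact: le_trans sq_up cube.
have lo' : (V * (r ^+ 2) ^+ 2) / kappa - (V * E * r ^+ 3) / kappa <= nf.
  rewrite -mulrBl ler_pdivrMr //; apply: le_trans low.
  by rewrite -[V * E * _]mulrA -mulrBr ler_pM2l // lerD2l lerN2 ler_pM2r.
rewrite ler_norml; apply/andP; split; lra.
Qed.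

End Counting.

Section Sieve.
Variables (R : realType) (K : fieldExtType rat).
Variables (iota : {rmorphism K -> R}) (sigma : {rmorphism K -> K}) (lambda : K).
Hypothesis hK : \dim {: K} = 2%N.
Hypothesis hsigma : nontrivial_automorphism sigma.
Hypothesis hlambda : fundamental_unit iota lambda.
Local Notation OK := (@ringOfIntegers K).
Local Notation N := (absnorm sigma iota).
Local Notation iota2 := (iota2 iota).
Local Notation sigma2 := (sigma2 iota sigma).
Implicit Types (A B : set (R * R)) (x : K * K).

Definition sifted A B (s : seq K) (a b : R) : set (K * K) :=
  [set x | [/\ OK x.1, OK x.2, x != 0, scaled a A (iota2 x) & scaled b B (sigma2 x)] /\
    forall p, p \in s -> ~ (OK_dvd p x.1 /\ OK_dvd p x.2)].

Definition scale2 (c : K) x : K * K := (c * x.1, c * x.2).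

Lemma scale2_inj c : c != 0 -> injective (scale2 c).
Proof. by move=> c0 [x1 x2] [y1 y2] [/(mulfI c0) -> /(mulfI c0) ->]. Qed.

Lemma scale2_eq0 c x : c != 0 -> (scale2 c x == 0) = (x == 0).
Proof.
move=> c0; apply/eqP/eqP => [|->]; last by rewrite /scale2 !mulr0.
move=> h; apply: (scale2_inj c0); rewrite h /scale2 !mulr0 //.
Qed.

Lemma pair_neq0 x : x != 0 -> x.1 != 0 \/ x.2 != 0.
Proof.
have [x10|] := eqVneq x.1 0; last by left.
have [x20|] := eqVneq x.2 0; last by right.
by case: x x10 x20 => x1 x2 /= -> -> /eqP.
Qed.

(** Multiplication by a unit trades the sizes of the two windows. *)
Lemma sifted_unit A B a b (u : K) : OK_unit u -> 0 < iota u -> 0 < iota (sigma u) ->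
  sifted A B [::] (a * iota u) (b * iota (sigma u)) =
  scale2 u @` sifted A B [::] a b.
Proof.
move=> [u0 Ou OV] iu isu.
have ne1 : iota u != 0 by rewrite gt_eqF.
have ne2 : iota (sigma u) != 0 by rewrite gt_eqF.
apply/seteqP; split => x.
  move=> [[ O1 O2 x0 Ax Bx] _].
  exists (scale2 u^-1 x); last by rewrite /scale2 /= !mulVKf //; case: (x).
  split=> //; split => /=; [exact: OKM|exact: OKM|by rewrite scale2_eq0 ?invr_eq0| |].
    by move: Ax; rewrite /scaled /= !rmorphM !fmorphV invfM !mulrA.
  by move: Bx; rewrite /scaled /= !rmorphM !fmorphV invfM !mulrA.
move=> [y [[ O1 O2 y0 Ay By] _] <-]; split => //; split => /=.
- exact: OKM.
- exact: OKM.
- by rewrite scale2_eq0.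
- by move: Ay; rewrite /scaled /= !rmorphM invfM -!mulrA !mulKf.
- by move: By; rewrite /scaled /= !rmorphM invfM -!mulrA !mulKf.
Qed.

Lemma sifted_norm A B M M' s a b x : 0 < a -> 0 < b ->
  (forall y, A y -> `|y.1| <= M /\ `|y.2| <= M) ->
  (forall y, B y -> `|y.1| <= M' /\ `|y.2| <= M') ->
  sifted A B s a b x -> N x.1 <= a * b * (M * M') /\ N x.2 <= a * b * (M * M').
Proof.
move=> a0 b0 hA hB [[_ _ _ /hA[/= a1 a2] /hB[/= b1 b2]] _].
have aux (c m z : R) : 0 < c -> `|c^-1 * z| <= m -> `|z| <= c * m.
  by move=> c0; rewrite normrM gtr0_norm ?invr_gt0 // ler_pdivrMl.
rewrite /absnorm !normrM.
have -> : a * b * (M * M') = (a * M) * (b * M') by ring.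
by split; apply: ler_pM => //; apply: aux.
Qed.

(** Up to units the two windows have comparable sizes, where the cell count applies;
windows with a small product of sizes are empty. *)
Lemma lattice_asymptotics : exists2 kappa : R, 0 < kappa & forall A B,
  convex_body A -> convex_body B -> exists2 C, 0 <= C & forall a b, 0 < a -> 0 < b ->
    finite_set (sifted A B [::] a b) /\
    `|cnt R (sifted A B [::] a b) - vol A * vol B / kappa * (a * b) ^+ 2| <=
      C * Num.sqrt (a * b) ^+ 3.
Proof.
have [w [ Ow w21 basis]] := integral_basis hK hsigma iota.
have k0 := covolume_gt0 w21.
set kappa := covolume _ _ in k0; exists kappa => // A B bA bB.
have [C C0 count] := lattice_count w21 bA bB.
have [_ _ vA0] := convex_body_vol bA; have [_ _ vB0] := convex_body_vol bB.
have [_ [M M0 hA] _] := bA; have [_ [M' M'0 hB] _] := bB.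
(* Unlike [lambda], its square has positive conjugate whatever the norm of [lambda]
is, so it acts on the windows by positive factors. *)
pose L := iota (lambda ^+ 2).
have l1 := proj1 hlambda; have l0 := iota_lambda_gt0 hlambda.
have L1 : 1 < L by rewrite /L rmorphXn exprn_egt1.
have L0 : 0 < L by apply: lt_trans L1.
have sL : iota (sigma (lambda ^+ 2)) = L^-1.
  rewrite /L !rmorphXn /= -[LHS]real_normK ?num_real //.
  by rewrite (sigma_lambda hK hsigma hlambda) exprVn.
(* A point of the windows has entries of norm at most [r ^ 2 * (M * M')], so for
[r < r0] there is no non-zero one. *)
pose r0 := (Num.sqrt (M * M'))^-1.
have MM0 : 0 < M * M' by rewrite mulr_gt0.
have r00 : 0 < r0 by rewrite invr_gt0 sqrtr_gt0.
pose V := vol A * vol B.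
have V0 : 0 < V by rewrite mulr_gt0.
pose D := 2 * C * L + C ^+ 2 / r0.
pose E := V * (2 * D + D ^+ 2 / r0) / kappa + r0^-1 ^+ 3.
have D0 : 0 <= D by rewrite addr_ge0 ?divr_ge0 ?mulr_ge0 ?exprn_ge0 ?ltW.
have E0 : 0 <= E.
  have e1 : 0 <= D ^+ 2 / r0 by rewrite divr_ge0 ?exprn_ge0 // ltW.
  have e2 : 0 <= 2 * D + D ^+ 2 / r0 by rewrite addr_ge0 // mulr_ge0.
  have e3 : 0 <= V * (2 * D + D ^+ 2 / r0) by rewrite mulr_ge0 // ltW.
  have e4 : 0 <= V * (2 * D + D ^+ 2 / r0) / kappa by rewrite divr_ge0 // ltW.
  by rewrite addr_ge0 // exprn_ge0 // invr_ge0 ltW.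
exists (Num.max E (V / kappa * r0)).
  by rewrite le_max E0.
(* Integral coordinates identify the lattice with the pairs of integers of [K]. *)
pose kpt (k : (int * int) * (int * int)) : K * K :=
  (k.1.1%:~R + k.1.2%:~R * w, k.2.1%:~R + k.2.2%:~R * w).
have kpt1 k : iota2 (kpt k) = (lattice_point (iota w) (iota (sigma w)) k).1.
  by rewrite /iota2 /= !rmorphD !rmorphM !rmorph_int.
have kpt2 k : sigma2 (kpt k) = (lattice_point (iota w) (iota (sigma w)) k).2.
  by rewrite /sigma2 /= !rmorphD !rmorphM !rmorph_int.
have kptO k : OK (kpt k).1 /\ OK (kpt k).2.
  by split; apply: OKD; try (apply: OKM => //); exact: OK_int.
have kptI : injective kpt.
  have aux (m n m' n' : int) : m%:~R + n%:~R * w = m'%:~R + n'%:~R * w -> m = m' /\ n = n'.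
    move=> e; have e1 := congr1 iota e; have e2 := congr1 (iota \o sigma) e.
    rewrite /= !rmorphD !rmorphM !rmorph_int in e1 e2.
    have d0 : iota w - iota (sigma w) != 0 by rewrite subr_eq0 gt_eqF.
    have nn : n%:~R = n'%:~R :> R by apply: (mulIf d0); lra.
    rewrite nn in e1; move/eqP: e1; rewrite (inj_eq (addIr _)) eqr_int => /eqP ->.
    by move/eqP: nn; rewrite eqr_int => /eqP ->.
  by move=> [[m n] [p q]] [[m' n'] [p' q']] [/aux[-> ->] /aux[-> ->]].
have kptS x : OK x.1 -> OK x.2 -> exists k, x = kpt k.
  move=> /basis[m [n mn]] /basis[p [q pq]]; exists ((m, n), (p, q)).
  by rewrite /kpt /= -mn -pq; case: (x).
have main a b : 0 < a -> 0 < b ->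
    a <= L * Num.sqrt (a * b) -> b <= L * Num.sqrt (a * b) ->
    Num.sqrt (a * b) <= L * a -> Num.sqrt (a * b) <= L * b ->
    finite_set (sifted A B [::] a b) /\
    `|cnt R (sifted A B [::] a b) - V / kappa * (a * b) ^+ 2| <=
      Num.max E (V / kappa * r0) * Num.sqrt (a * b) ^+ 3.
  move=> a0 b0 aL bL ra rb; have [finZ up lo] := count a b a0 b0.
  set Z := [set k | _] in finZ up lo.
  set r := Num.sqrt (a * b) in aL bL ra rb *.
  have ab0 : 0 < a * b by rewrite mulr_gt0.
  have r0' : 0 < r by rewrite sqrtr_gt0.
  have r2 : a * b = r ^+ 2 by rewrite sqr_sqrtr // ltW.
  have ZE : sifted A B [::] a b = (kpt @` Z) `\` [set 0].
    apply/seteqP; split => x.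
      move=> [[ O1 O2 /eqP x0 Ax Bx] _]; split => //.
      by have [k xE] := kptS x O1 O2; exists k => //; split; rewrite -?kpt1 -?kpt2 -xE.
    move=> [[k [kA kB] <-] /eqP k0']; have [ O1 O2] := kptO k.
    by split => //; split => //; rewrite ?kpt1 ?kpt2.
  have finI : finite_set (kpt @` Z) by exact: finite_image.
  have finS : finite_set (sifted A B [::] a b) by rewrite ZE; exact: finite_setD.
  split=> //; rewrite r2.
  have [rr0|rr0] := leP r0 r; last first.
    have -> : sifted A B [::] a b = set0.
      apply/seteqP; split => // x Sx.
      have [n1 n2] := sifted_norm a0 b0 hA hB Sx.
      have [[ O1 O2 x0 _ _] _] := Sx.
      have ab1 : a * b * (M * M') < 1.
        rewrite -ltr_pdivlMr // div1r r2.
        have -> : (M * M')^-1 = r0 ^+ 2 by rewrite exprVn sqr_sqrtr // ltW.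
        by rewrite ltr_pXn2r ?nnegrE // ltW.
      have [/(absnorm_ge1 hK hsigma iota O1)|/(absnorm_ge1 hK hsigma iota O2)] := pair_neq0 x0.
        by move=> h; have := lt_le_trans ab1 (le_trans h n1); rewrite ltxx.
      by move=> h; have := lt_le_trans ab1 (le_trans h n2); rewrite ltxx.
    rewrite cnt_set0 sub0r normrN ger0_norm; last by rewrite mulr_ge0 ?divr_ge0 ?exprn_ge0 // ltW.
    have -> : V / kappa * (r ^+ 2) ^+ 2 = V / kappa * r * r ^+ 3 by ring.
    rewrite ler_pM2r ?exprn_gt0 // le_max; apply/orP; right.
    by rewrite ler_pM2l ?divr_gt0 // ltW.
  apply: (@le_trans _ _ (E * r ^+ 3)); last first.
    by rewrite ler_pM2r ?exprn_gt0 // le_max lexx.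
  have cI : cnt R (kpt @` Z) = cnt R Z by apply: cnt_image.
  apply: (cell_bounds_asymp r00 rr0 C0 (ltW L1) a0 b0 r2 aL bL ra rb V0 k0 _ _ (cnt_ge0 R Z) up lo (erefl D)).
    rewrite ZE; have [z0|z0] := pselect ((kpt @` Z) 0).
      rewrite cnt_setD //; last by move=> _ ->.
      by rewrite cI cnt_set1.
    rewrite setDidl; first by rewrite cI lerBlDr lerDl.
    by apply/seteqP; split => // x [xZ x0]; apply: z0; rewrite -x0.
  rewrite ZE -cI /cnt ler_nat; apply: fsubset_leq_card.
  rewrite -fset_set_sub; [exact: subDsetl|exact: finite_setD|exact: finI].
move=> a b a0 b0.
have ab0 : 0 < a * b by rewrite mulr_gt0.
set r := Num.sqrt (a * b).
have rp : 0 < r by rewrite sqrtr_gt0.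
have r2 : r ^+ 2 = a * b by rewrite sqr_sqrtr // ltW.
have [k /andP[k1 k2]] := expz_bracket L1 (divr_gt0 a0 rp).
pose u := (lambda ^+ 2) ^ k.
have uu : OK_unit u by rewrite /u (exprnP lambda 2) exprz_exp; apply: (unit_lambdaX hlambda).
have iu : iota u = L ^ k by rewrite /u fmorphXz.
have isu : iota (sigma u) = (L ^ k)^-1 by rewrite /u !fmorphXz sL exprz_inv invr_expz.
have Lk : 0 < L ^ k by rewrite exprz_gt0.
have isu0 : 0 < iota (sigma u) by rewrite isu invr_gt0.
have iu0 : 0 < iota u by rewrite iu.
set a' := a * iota u; set b' := b * iota (sigma u).
have ab' : a' * b' = a * b.
  by rewrite /a' /b' iu isu mulrACA divff ?mulr1 // gt_eqF.
have a'0 : 0 < a' by rewrite mulr_gt0.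
have b'0 : 0 < b' by rewrite mulr_gt0.
have ra' : r <= a'.
  by move: k1; rewrite mulrA ler_pdivlMr // mul1r /a' iu mulrC.
have aL' : a' < L * r.
  by move: k2; rewrite mulrA ltr_pdivrMr // /a' iu mulrC.
have br' : b' <= r.
  rewrite -(ler_pM2l a'0) ab' -r2 expr2; by rewrite ler_pM2r.
have rb' : r <= L * b'.
  rewrite -(ler_pM2l a'0) mulrCA ab' -r2 expr2 mulrA ler_pM2r //.
  exact: ltW.
have rL c : 0 < c -> c <= L * c by move=> c0; rewrite ler_peMl // ltW.
have [] := main a' b' a'0 b'0; rewrite ?ab' //.
- exact: ltW.
- exact: le_trans br' (rL _ rp).
- exact: le_trans ra' (rL _ a'0).
rewrite (sifted_unit A B a b uu iu0 isu0) => fin.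
have u0 : u != 0 by case: uu.
have finS : finite_set (sifted A B [::] a b).
  have -> : sifted A B [::] a b = scale2 u^-1 @` (scale2 u @` sifted A B [::] a b).
    rewrite image_comp -[LHS]image_id; apply: eq_imagel => x _ /=.
    by rewrite /scale2 /= !mulKf //; case: (x).
  exact: finite_image.
by rewrite cnt_image //; exact: scale2_inj.
Qed.

Lemma scaled_phys A p a x :
  scaled (a / iota p) A (iota2 x) <-> scaled a A (iota2 (scale2 p x)).
Proof. by rewrite /scaled /= !rmorphM invf_div ![_ / a]mulrC !mulrA. Qed.

(** The sign of the conjugate of [p] is absorbed by the symmetry of the window. *)
Lemma scaled_int B p b x : (forall u, B u <-> B (- u.1, - u.2)) ->
  scaled (b / `|iota (sigma p)|) B (sigma2 x) <-> scaled b B (sigma2 (scale2 p x)).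
Proof.
move=> symB; rewrite /scaled /= !rmorphM invf_div.
have [h|h] := ltP 0 (iota (sigma p)).
  by rewrite gtr0_norm // ![_ / b]mulrC !mulrA.
by rewrite ler0_norm // symB /= ![_ / b]mulrC !mulrN !mulNr !opprK !mulrA.
Qed.

Lemma sifted_cons A B p s a b : (forall u, B u <-> B (- u.1, - u.2)) ->
  OK_prime p -> 0 < iota p -> (forall q, q \in s -> OK_prime q /\ ~ OK_dvd q p) ->
  sifted A B (p :: s) a b = sifted A B s a b `\`
    (scale2 p @` sifted A B s (a / iota p) (b / `|iota (sigma p)|)).
Proof.
move=> symB [ Op p0 _ _] ip sP.
apply/seteqP; split => x.
  move=> [hx ps]; split.
    by split => // q qs; apply: ps; rewrite inE qs orbT.
  move=> [y [[ Oy1 Oy2 _ _ _] _] xE]; apply: (ps p); first by rewrite inE eqxx.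
  by rewrite -xE; split; [exists y.1|exists y.2]; rewrite //= mulrC.
move=> [[[ O1 O2 x0 Ax Bx] ss] np]; split => // q; rewrite inE => /orP[/eqP ->|]; last exact: ss.
move=> [[c Oc cE] [d Od dE]]; apply: np.
have xE : scale2 p (c, d) = x by rewrite /scale2 /= ![p * _]mulrC -cE -dE; case: (x).
exists (c, d) => //; split.
  split => //; first by rewrite -(scale2_eq0 _ p0) xE.
    by apply/scaled_phys; rewrite xE.
  by apply/(scaled_int _ _ _ symB); rewrite xE.
move=> r rs [/= [e Oe eE] [f Of fE]]; apply: (ss r rs); rewrite cE dE eE fE.
by split; [exists (e * p)|exists (f * p)]; rewrite ?[_ * r * p]mulrAC //; apply: OKM.
Qed.

Lemma scale2_sifted A B p s a b : (forall u, B u <-> B (- u.1, - u.2)) ->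
  OK_prime p -> 0 < iota p -> (forall q, q \in s -> OK_prime q /\ ~ OK_dvd q p) ->
  (scale2 p @` sifted A B s (a / iota p) (b / `|iota (sigma p)|)) `<=` sifted A B s a b.
Proof.
move=> symB [ Op p0 _ _] ip sP _ [y [[ Oy1 Oy2 y0 Ay By] ys] <-].
split.
  split; [exact: OKM|exact: OKM|by rewrite scale2_eq0|exact/scaled_phys|].
  exact/(scaled_int _ _ _ symB).
move=> q qs [/= d1 d2]; have [[ Oq q0 nuq qP] nqp] := sP q qs.
apply: (ys q qs); split.
  by have [] := qP _ _ Op Oy1 d1.
by have [] := qP _ _ Op Oy2 d2.
Qed.

(** The multiples of [p] removed in one step are counted by windows of product
[a * b / N p].  Subtracting the two main terms gives the factor [1 - N p ^ (- 2)], and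
adding the two error terms gives the factor [1 + N p ^ (- 3 / 2)]. *)
Lemma sieve A B (c C : R) (s : seq K) : (forall u, B u <-> B (- u.1, - u.2)) ->
  (forall a b, 0 < a -> 0 < b -> finite_set (sifted A B [::] a b) /\
    `|cnt R (sifted A B [::] a b) - c * (a * b) ^+ 2| <= C * Num.sqrt (a * b) ^+ 3) ->
  (forall p, p \in s -> OK_prime p /\ 0 < iota p) ->
  pairwise (fun p q => ~~ `[< OK_dvd q p >]) s ->
  forall a b, 0 < a -> 0 < b -> finite_set (sifted A B s a b) /\
    `|cnt R (sifted A B s a b) - c * \prod_(p <- s) (1 - weight iota sigma p ^+ 4) * (a * b) ^+ 2| <=
      C * \prod_(p <- s) (1 + weight iota sigma p ^+ 3) * Num.sqrt (a * b) ^+ 3.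
Proof.
move=> symB base; elim: s => [|p s IH] sP.
  by move=> _ a b a0 b0; rewrite !big_nil !mulr1; exact: base.
rewrite pairwise_cons => /andP[/allP ps pws] a b a0 b0.
have [pp ip] : OK_prime p /\ 0 < iota p by apply: sP; rewrite inE eqxx.
have sP' q : q \in s -> OK_prime q /\ 0 < iota q by move=> qs; apply: sP; rewrite inE qs orbT.
have sP'' q : q \in s -> OK_prime q /\ ~ OK_dvd q p.
  by move=> qs; split; [case: (sP' q qs)|apply/asboolPn; exact: ps].
have p0 : p != 0 by case: pp.
have sp0 : 0 < `|iota (sigma p)| by rewrite normr_gt0 !fmorph_eq0.
have [fin1 e1] := IH sP' pws a b a0 b0.
have [fin2 e2] := IH sP' pws _ _ (divr_gt0 a0 ip) (divr_gt0 b0 sp0).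
rewrite (sifted_cons A a b symB pp ip sP''); split; first exact: finite_setD.
rewrite cnt_setD //; last exact: scale2_sifted.
rewrite cnt_image //; last exact: scale2_inj.
have Np : iota p * `|iota (sigma p)| = absnorm sigma iota p.
  by rewrite /absnorm normrM gtr0_norm.
have Np0 : 0 < N p by rewrite -Np mulr_gt0.
have w2 : weight iota sigma p ^+ 2 = (N p)^-1.
  by rewrite /weight exprVn sqr_sqrtr // ltW.
have abp : a / iota p * (b / `|iota (sigma p)|) = a * b * weight iota sigma p ^+ 2.
  by rewrite w2 -Np invfM; ring.
have w0 := weight_gt0 iota sigma p0.
have sq : Num.sqrt (a * b * weight iota sigma p ^+ 2) = Num.sqrt (a * b) * weight iota sigma p.
  by rewrite sqrtrM ?mulr_ge0 ?ltW // sqrtr_sqr gtr0_norm.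
rewrite abp sq in e2; rewrite !big_cons.
set w := weight iota sigma p in e2 *.
set P := \prod_(q <- s) _ in e1 e2 *.
set P' := \prod_(q <- s) _ in e1 e2 *.
set n1 := cnt R _ in e1 *; set n2 := cnt R _ in e2 *.
have -> : n1 - n2 - c * ((1 - w ^+ 4) * P) * (a * b) ^+ 2 =
  (n1 - c * P * (a * b) ^+ 2) - (n2 - c * P * (a * b * w ^+ 2) ^+ 2) by ring.
apply: le_trans (ler_normB _ _) _; apply: le_trans (lerD e1 e2) _.
by rewrite le_eqVlt; apply/orP; left; apply/eqP; ring.
Qed.

End Sieve.

(** * The density of visible points *)

Section Window.
Variables (R : realType) (W : set (R * R)).
Hypothesis hW : hammarhjelm_window W.

Lemma window_opp u : W u <-> W (- u.1, - u.2).
Proof.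
have [_ _ _ sW] := hW.
have opp v : W v -> W (- v.1, - v.2) by move=> Wv; rewrite sW; exists v.
by split=> [/opp//|/opp /=]; rewrite !opprK; case: u.
Qed.

Lemma window_star t w : `|t| <= 1 -> W w -> W (t * w.1, t * w.2).
Proof.
rewrite ler_norml => /andP[t1 t2] Ww; have [_ _ /convex2_pair cW _] := hW.
have a01 : 0 <= (1 + t) / 2 <= 1 by apply/andP; split; lra.
have := cW _ _ _ a01 Ww ((window_opp w).1 Ww).
by congr (W (_, _)) => /=; field.
Qed.

Lemma window_body : convex_body W.
Proof.
have [[bW _] iW cW _] := hW.
by split => //; [exact: convex2_pair|exact: bounded_set_pair].
Qed.

End Window.

Section VisibleCount.
Variables (R : realType) (K : fieldExtType rat).
Variables (iota : {rmorphism K -> R}) (sigma : {rmorphism K -> K}) (lambda : K).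
Variable W : set (R * R).
Hypothesis hK : \dim {: K} = 2%N.
Hypothesis hPID : OK_pid K.
Hypothesis hsigma : nontrivial_automorphism sigma.
Hypothesis hlambda : fundamental_unit iota lambda.
Hypothesis hHam : hammarhjelm_condition iota sigma lambda.
Hypothesis hW : hammarhjelm_window W.
Local Notation N := (absnorm sigma iota).
Local Notation Lvis := (visible (cut_and_project W (minkowski_lattice iota sigma))).
Local Notation L := (iota lambda).

(** In a bounded region only primes of bounded norm obstruct primitivity, so a
sufficiently long list of primes detects it. *)
Lemma visible_sifted (D : set (R * R)) (M M' T : R) (Q : nat) (s : seq K) : 0 < T ->
  (forall y, dilate 1 D y -> `|y.1| <= M /\ `|y.2| <= M) ->
  (forall y, W y -> `|y.1| <= M' /\ `|y.2| <= M') ->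
  T * (M * M') < Q%:R ->
  (forall p, p \in s -> OK_prime p) ->
  (forall r, OK_prime r -> N r < Q%:R -> exists2 p, p \in s & OK_dvd p r) ->
  Lvis `&` dilate T D = iota2 iota @`
    (sifted iota sigma (dilate 1 D) W s T 1 `\` sifted iota sigma (dilate 1 D) W s T L^-1).
Proof.
move=> T0 hD hW' TQ sP sQ.
rewrite (visible_primitive hK hPID hsigma hlambda hHam (window_star hW)).
have sc1 v : scaled 1 W v <-> W v by rewrite /scaled invr1 !mul1r; case: v.
have scl v : scaled L^-1 W v <-> W (L * v.1, L * v.2) by rewrite /scaled invrK.
apply/seteqP; split => y.
  move=> [[x [ O1 O2 px Wx nWx] <-] /(dilate_scale _ _ T0) Dx].
  exists x => //; split; last by move=> [[_ _ _ _ /scl]].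
  split; last by move=> p /sP pp; apply: px.
  split => //; last by apply/sc1.
  apply/eqP => x0; apply: nWx; move: Wx.
  by rewrite x0 /sigma2 /= !rmorph0 mulr0.
move=> [x [hx nx] <-]; have [[ O1 O2 x0 Dx /sc1 Wx] sx] := hx.
split; last by apply/(dilate_scale _ _ T0).
exists x => //; split => //; last first.
  by move=> /scl Wx'; apply: nx.
move=> p pp [d1 d2].
have [n1 n2] := sifted_norm T0 ltr01 hD hW' hx; rewrite mulr1 in n1 n2.
have Np (z : K) : ringOfIntegers z -> z != 0 -> OK_dvd p z -> N z <= T * (M * M') -> N p < Q%:R.
  move=> Oz z0 [c Oc zE] nz; apply: le_lt_trans TQ; apply: le_trans nz.
  rewrite zE absnormM ler_peMl ?normr_ge0 // (absnorm_ge1 hK hsigma) //.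
  by apply: contraNneq z0 => c0; rewrite zE c0 mul0r.
have [q qs [e Oe pE]] : exists2 q, q \in s & OK_dvd q p.
  apply: sQ => //; have [z0|z0] := pair_neq0 x0; first exact: Np n1.
  exact: Np n2.
apply: (sx q qs); case: d1 d2 => [c Oc ->] [d Od ->].
by split; [exists (c * e)|exists (d * e)]; rewrite ?pE ?mulrA //; apply: OKM.
Qed.

(** The length [Q] of the list of primes enters the left-hand side of [step] only
through the partial Euler product, and the right-hand side not at all.  So [Q] may
tend to infinity with [T] fixed. *)
Lemma visible_count_bound : exists theta : R, forall D, averaging_set D -> convex2 D ->
  exists2 E, 0 <= E & forall T, 0 < T ->
    `|frequency Lvis D T - theta| <= E * (Num.sqrt T)^-1.
Proof.
have [s [sP spw scov [M Mb] [l sl]]] := prime_sequence hK hsigma hlambda hHam.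
have [kappa k0 asymp] := lattice_asymptotics hK hsigma hlambda.
have bW := window_body hW.
have l1 := proj1 hlambda; have l0 := iota_lambda_gt0 hlambda.
have li0 : 0 < L^-1 by rewrite invr_gt0.
have li1 : L^-1 <= 1 by rewrite invf_le1 // ltW.
exists (vol W / kappa * l * (1 - L^-1 ^+ 2)) => D aD cD.
have bS := dilate_body aD cD; set S := dilate 1 D in bS.
have [_ _ vS0] := convex_body_vol bS.
have [C C0 base] := asymp S W bS bW.
have [_ [B B0 hB] _] := bS; have [_ [B' B'0 hB'] _] := bW.
have Pp0 Q : 0 <= \prod_(p <- s Q) (1 + weight iota sigma p ^+ 3).
  rewrite big_seq prodr_ge0 // => p /sP[[_ p0 _ _] _].
  by rewrite addr_ge0 // exprn_ge0 // ltW // weight_gt0.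
have M0 : 0 <= M by apply: le_trans (Mb 0%N).
set c := vol S * vol W / kappa in base.
exists (2 * C * M / vol S); first by rewrite divr_ge0 ?mulr_ge0 // ltW.
move=> T T0; have sT0 : 0 < Num.sqrt T by rewrite sqrtr_gt0.
set n : R := cnt R (Lvis `&` dilate T D).
pose P Q := \prod_(p <- s Q) (1 - weight iota sigma p ^+ 4).
have step Q : T * (B * B') < Q%:R ->
    `|n - c * P Q * ((1 - L^-1 ^+ 2) * T ^+ 2)| <= 2 * C * M * Num.sqrt T ^+ 3.
  move=> TQ.
  have sv := sieve (window_opp hW) base (sP Q) (spw Q).
  have [fin1 e1] := sv T 1 T0 ltr01; have [fin2 e2] := sv T L^-1 T0 li0.
  have -> : n = cnt R (sifted iota sigma S W (s Q) T 1) - cnt R (sifted iota sigma S W (s Q) T L^-1).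
    rewrite /n (visible_sifted T0 hB hB' TQ (fun p ps => (sP Q p ps).1) (scov Q)).
    rewrite cnt_image; last exact: iota2_inj.
      rewrite cnt_setD // => x [[ O1 O2 x0 Sx Wx] xs]; split => //; split => //.
      have := window_star hW (t := L^-1) _ Wx; rewrite ger0_norm ?(ltW li0) //.
      by move=> /(_ li1); rewrite /scaled /= invrK invr1 !mulKf ?gt_eqF // !mul1r.
    exact: finite_setD.
  rewrite -/(P Q) mulr1 in e1; rewrite -/(P Q) in e2.
  set n1 := cnt R _ in e1 *; set n2 := cnt R _ in e2 *.
  have -> : n1 - n2 - c * P Q * ((1 - L^-1 ^+ 2) * T ^+ 2) =
    (n1 - c * P Q * T ^+ 2) - (n2 - c * P Q * (T * L^-1) ^+ 2) by ring.
  have PM : C * \prod_(p <- s Q) (1 + weight iota sigma p ^+ 3) <= C * M by rewrite ler_wpM2l.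
  apply: le_trans (ler_normB _ _) _.
  have -> : 2 * C * M * Num.sqrt T ^+ 3 = C * M * Num.sqrt T ^+ 3 + C * M * Num.sqrt T ^+ 3 by ring.
  apply: lerD.
    by apply: le_trans e1 _; rewrite ler_wpM2r // exprn_ge0 // ltW.
  apply: le_trans e2 _; apply: ler_pM => //.
    by rewrite mulr_ge0 // Pp0.
  by rewrite ler_pXn2r ?nnegrE ?sqrtr_ge0 // ler_wsqrtr // ler_piMr // ltW.
have lim : `|n - c * l * ((1 - L^-1 ^+ 2) * T ^+ 2)| <= 2 * C * M * Num.sqrt T ^+ 3.
  apply/ler_addgt0Pr => e e0.
  set k := (1 - L^-1 ^+ 2) * T ^+ 2 in step *.
  have k1 : 0 < `|c * k| + 1 by rewrite ltr_pwDr.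
  have [Q0 _ HQ0] : \forall Q \near \oo, `|l - P Q| < e / (`|c * k| + 1).
    by move/cvgrPdist_lt : sl; apply; rewrite divr_gt0.
  pose Q := maxn Q0 (Num.truncn (T * (B * B'))).+1.
  have HQ : `|l - P Q| < e / (`|c * k| + 1) by apply: HQ0; rewrite /= leq_maxl.
  have TQ : T * (B * B') < Q%:R.
    by apply: (lt_le_trans (truncnS_gt _)); rewrite ler_nat leq_maxr.
  have -> : n - c * l * k = (n - c * P Q * k) - c * k * (l - P Q) by ring.
  apply: le_trans (ler_normB _ _) _; apply: lerD; first exact: step.
  rewrite normrM; apply: (@le_trans _ _ ((`|c * k| + 1) * `|l - P Q|)).
    by rewrite ler_wpM2r // lerDl.
  by rewrite mulrC -ler_pdivlMr // ltW.
rewrite /frequency vol_dilate // -/S -/(cnt R (Lvis `&` dilate T D)) -/n.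
have T2 : T = Num.sqrt T ^+ 2 by rewrite sqr_sqrtr // ltW.
have den0 : 0 < T ^+ 2 * vol S by rewrite mulr_gt0 // exprn_gt0.
have -> : n / (T ^+ 2 * vol S) - vol W / kappa * l * (1 - L^-1 ^+ 2) =
    (n - c * l * ((1 - L^-1 ^+ 2) * T ^+ 2)) / (T ^+ 2 * vol S).
  rewrite /c; field; rewrite !gt_eqF //.
rewrite normrM [X in _ * X]gtr0_norm ?invr_gt0 // ler_pdivrMr //.
apply: le_trans lim _; rewrite le_eqVlt; apply/orP; left; apply/eqP.
have -> : T ^+ 2 = Num.sqrt T ^+ 4 by rewrite {1}T2 -exprM.
move: (Num.sqrt T) sT0 => q q0.
by field; rewrite !gt_eqF.
Qed.

End VisibleCount.

(** The error [T ^ (- 1 / 2)] in terms of the area [T ^ 2 * v]. *)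
Lemma inv_sqrt_powR (R : realType) (T v : R) : 0 < T -> 0 < v ->
  (Num.sqrt T)^-1 = v `^ (1 / 4) * (T ^+ 2 * v) `^ (- (1 / 4)).
Proof.
move=> T0 v0; rewrite powRM ?exprn_ge0 ?ltW //.
rewrite -(powR_mulrn 2 (ltW T0)) -powRrM mulrCA -powRD; last first.
  by apply/implyP => _; rewrite gt_eqF.
rewrite subrr powRr0 mulr1.
have -> : 2%:R * - (1 / 4) = - 2^-1 :> R by field.
by rewrite powRN powR12_sqrt // ltW.
Qed.

Unset Implicit Arguments.
Set Strict Implicit.
Set Printing Implicit Defensive.

Theorem theorem1p3 (R : realType) (K : fieldExtType rat)
  (iota : {rmorphism K -> R}) (sigma : {rmorphism K -> K}) (lambda : K)
  (W : set (R * R))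
  (hK : \dim {: K} = 2%N)
  (hPID : OK_pid K)
  (hsigma : nontrivial_automorphism sigma)
  (hlambda : fundamental_unit iota lambda)
  (hHam : hammarhjelm_condition iota sigma lambda)
  (hW : hammarhjelm_window W) :
  let Lvis := visible (cut_and_project W (minkowski_lattice iota sigma)) in
  exists theta : R,
    forall D : set (R * R), averaging_set D -> convex2 D ->
      asymptotic_density Lvis D theta /\
      forall eps : R, 0 < eps ->
        exists C : R, \forall T \near +oo,
          `|frequency Lvis D T - theta|
            <= C * vol (dilate T D) `^ (- (1 / 4) + eps).
Proof.
move=> Lvis.
have [theta main] := visible_count_bound hK hPID hsigma hlambda hHam hW.
exists theta => D aD cD; have [E E0 bound] := main D aD cD.
split.
  apply/cvgrPdist_le => e e0; near=> T.
  have T0 : 0 < T by near: T; apply: nbhs_pinfty_gt; rewrite num_real.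
  rewrite distrC; apply: le_trans (bound T T0) _.
  rewrite ler_pdivrMr ?sqrtr_gt0 // mulrC -ler_pdivrMr //.
  have h : (E / e) ^+ 2 <= T by near: T; apply: nbhs_pinfty_ge; rewrite num_real.
  have Ee : 0 <= E / e by rewrite divr_ge0 // ltW.
  by rewrite -(ger0_norm Ee) -sqrtr_sqr ler_wsqrtr.
move=> eps eps0.
have [_ _ v0] := convex_body_vol (dilate_body aD cD).
set v := vol _ in v0.
exists (E * v `^ (1 / 4)); near=> T.
have T0 : 0 < T by near: T; apply: nbhs_pinfty_gt; rewrite num_real.
apply: le_trans (bound T T0) _.
rewrite (inv_sqrt_powR T0 v0) mulrA vol_dilate // -/v.
rewrite ler_wpM2l ?mulr_ge0 ?powR_ge0 //; apply: ler_powR; last by rewrite lerDl ltW.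
(* Raising the exponent by [eps] needs an area of at least [1]. *)
have T1 : 1 <= T by near: T; apply: nbhs_pinfty_ge; rewrite num_real.
have Tv : v^-1 <= T by near: T; apply: nbhs_pinfty_ge; rewrite num_real.
rewrite -ler_pdivrMr // div1r expr2; apply: le_trans Tv _.
by rewrite ler_peMl // ltW.
Unshelve. all: by end_near.
Qed.
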